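(* Let $G$ be a $\sigma$-compact locally compact metrizable group, $\Gamma\subset G$ a discrete subgroup, and $X=G/\Gamma$. Suppose that $X$ admits a Haar measure and has at most quadratic growth. Let $\mu$ be an adapted symmetric spread out Borel probability measure on $G$ with compact support. Then the random walk on $X$ given by $\mu$ is topologically Harris recurrent.
   Context: A Haar measure $m_X$ on $X$ is a non-trivial $G$-invariant Radon measure on $X$. Growth: $X$ has polynomial growth of degree at most $d$ if there exist a generating relatively compact neighborhood $V$ of the identity in $G$ and $x\in X$ such that $\limsup_{n\to\infty} m_X(V^nx)/n^d<\infty$ (it is known that this then holds for all choices of $x$ and $V$). At most quadratic growth means $d=2$. $\mu$ is adapted if the closed subgroup of $G$ generated by $\operatorname{supp}(\mu)$ is $G$; symmetric if $\mu(B)=\mu(B^{-1})$ for all measurable $B\subset G$; spread out if for some $n_0\in\mathbb{N}$ the convolution power $\mu^{*n_0}$ is not singular with respect to Haar measure on $G$. The random walk on $X$ given by $\mu$ and started at $x$ is $\Phi_n=Y_n\cdots Y_1x$ with $(Y_k)$ i.i.d. of law $\mu$; $\mathbb{P}_x$ denotes the corresponding probability measure. The random walk is topologically Harris recurrent if for all $x\in X$ and all neighborhoods $B$ of $x$ one has $\mathbb{P}_x[\Phi_n\in B\text{ infinitely often}]=1$. *)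

(* Defs.v *)
From HB Require Import structures.
From mathcomp Require Import all_boot all_order all_algebra.
From mathcomp Require Import finmap.
From mathcomp Require Import all_classical all_reals all_analysis.

Set Implicit Arguments.
Unset Strict Implicit.
Unset Printing Implicit Defensive.

Import Order.TTheory GRing.Theory Num.Theory.
Import numFieldNormedType.Exports.

Local Open Scope classical_set_scope.
Local Open Scope ring_scope.
Local Open Scope group_scope.

(* The Pointed superclass carries no content (a group is inhabited); it is
   there because measurable types of the library are pointed. *)
HB.mixin Record isTopologicalGroup G & Group G & PointedTopological G := {
  mulg_continuous : continuous (fun p : G * G => p.1 * p.2) ;
  invg_continuous : continuous (fun x : G => x^-1)
}.

#[short(type="topologicalGroupType")]
HB.structure Definition TopologicalGroup :=
  {G of Group G & PointedTopological G & isTopologicalGroup G}.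

Notation borelType T := (g_sigma_algebraType (@open T)).

Section Topology.

Definition sigma_compact (T : topologicalType) : Prop :=
  exists2 K : nat -> set T, forall n, compact (K n) & \bigcup_n K n = setT.

Definition metrizable (R : realType) (T : topologicalType) : Prop :=
  exists d : T -> T -> R,
    [/\ forall x y, d x y = 0%R <-> x = y,
        forall x y, d x y = d y x,
        forall x y z, (d x z <= d x y + d y z)%R &
        forall (x : T) (A : set T), nbhs x A <->
          exists2 e : R, (0 < e)%R & [set y | (d x y < e)%R] `<=` A].

Definition discrete_subset (T : topologicalType) (A : set T) : Prop :=
  A `<=` isolated A.

End Topology.

Section CosetSpace.
Local Open Scope quotient_scope.
Variables (G : topologicalGroupType) (Gamma : groupClosed G).

(* x Gamma = y Gamma *)
Definition lcoset_rel : rel G := fun x y => x^-1 * y \in Gamma.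

Lemma lcoset_rel_refl : reflexive lcoset_rel.
Proof. by move=> x; rewrite /lcoset_rel mulVg gpred1. Qed.

Lemma lcoset_rel_sym : symmetric lcoset_rel.
Proof. by move=> x y; rewrite /lcoset_rel -gpredV invgM invgK. Qed.

Lemma lcoset_rel_trans : transitive lcoset_rel.
Proof.
rewrite /lcoset_rel => y x z xy yz.
have -> : x^-1 * z = (x^-1 * y) * (y^-1 * z) by rewrite -mulgA mulVKg.
exact: gpredM.
Qed.

Canonical lcoset_equiv :=
  EquivRel lcoset_rel lcoset_rel_refl lcoset_rel_sym lcoset_rel_trans.

Definition coset_space := quotient_topology {eq_quot lcoset_equiv}.

HB.instance Definition _ := PointedTopological.on coset_space.
HB.instance Definition _ := Quotient.on coset_space.

Definition coset_act (g : G) (x : coset_space) : coset_space :=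
  \pi_coset_space (g * repr x).

Lemma coset_actE (g h : G) :
  coset_act g (\pi_coset_space h) = \pi_coset_space (g * h).
Proof.
apply/eqmodP; rewrite /= /lcoset_rel invgM -mulgA mulKg.
have /eqmodP : \pi_({eq_quot lcoset_equiv}) (repr (\pi_coset_space h)) =
       \pi_({eq_quot lcoset_equiv}) h by exact: reprK.
by [].
Qed.

End CosetSpace.

Section HaarMeasure.
Context {R : realType} {T : ptopologicalType}.

Definition radon (m : {measure set (borelType T) -> \bar R}) : Prop :=
  [/\ forall K : set T, compact K -> (m K < +oo)%E,
      forall A : set (borelType T), measurable A ->
        m A = ereal_inf [set m U | U in [set U : set T | open U /\ A `<=` U]] &
      forall U : set T, open U ->
        m U =
        ereal_sup [set m K | K in [set K : set T | compact K /\ K `<=` U]]].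

Definition haar {G : topologicalGroupType} (act : G -> T -> T)
    (m : {measure set (borelType T) -> \bar R}) : Prop :=
  [/\ radon m, m setT <> 0%E &
      forall (g : G) (A : set (borelType T)), measurable A ->
        m (act g @` A) = m A].

End HaarMeasure.

Section Growth.
Context {R : realType} {G : topologicalGroupType} {X : ptopologicalType}.
Variable act : G -> X -> X.

Definition setpowg (V : set G) (n : nat) : set G :=
  iter n (fun A => [set v * a | v in V & a in A]) [set 1].

(* V is generating when the products of its elements exhaust G; inverses are
   not used: for a nonsymmetric V generating G merely as a group, the growth
   of V^n x may depend on V and x. At n = 0 the quotient is 0. *)
Definition poly_growth (m : {measure set (borelType X) -> \bar R}) (d : nat)
    : Prop :=
  exists (V : set G) (x : X),
    let Vx n : set (borelType X) := (fun g => act g x) @` setpowg V n in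
    [/\ nbhs (1 : G) V, precompact V, \bigcup_n setpowg V n = setT,
        forall n, measurable (Vx n) &
        (limn_esup (fun n => m (Vx n) * ((n%:R ^+ d)^-1)%R%:E) < +oo)%E].

End Growth.

Section StepDistribution.
Context {R : realType} {G : topologicalGroupType}.

Definition msupp (mu : {measure set (borelType G) -> \bar R}) : set G :=
  [set x | forall U : set G, open U -> U x -> (0 < mu U)%E].

Definition closed_subgroup (H : set G) : Prop :=
  closed H /\ group_closed [in H].

Definition adapted (mu : probability (borelType G) R) : Prop :=
  smallest closed_subgroup (msupp mu) = setT.

Definition symmetric_law (mu : probability (borelType G) R) : Prop :=
  forall B : set (borelType G), measurable B ->
    mu B = mu [set (x : G)^-1 | x in B].

Definition convolution (m1 m2 : set (borelType G) -> \bar R) :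
    set (borelType G) -> \bar R :=
  pushforward (m1 \x m2)%E
    (fun p : borelType G * borelType G => (p.1 : G) * (p.2 : G) : borelType G).

Definition convpow (m : set (borelType G) -> \bar R) (n : nat) :
    set (borelType G) -> \bar R :=
  iter n (convolution m) (\d_(1 : borelType G)).

Definition mutually_singular (m1 m2 : set (borelType G) -> \bar R) : Prop :=
  exists A : set (borelType G),
    [/\ measurable A, m1 A = 0%E & m2 (~` A) = 0%E].

(* Haar measures on G differ by a positive factor, so that it does not matter
   which one is used. *)
Definition spread_out (mu : probability (borelType G) R) : Prop :=
  exists (mG : {measure set (borelType G) -> \bar R}) (n : nat),
    [/\ haar (fun g x : G => g * x) mG, (0 < n)%N &
        ~ mutually_singular (convpow mu n) mG].

End StepDistribution.

Section RandomWalk.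
Context {R : realType} {G : topologicalGroupType} {X : ptopologicalType}.
Variable act : G -> X -> X.

Definition independent_rvs d (Omega : measurableType d)
    (P : probability Omega R) (Y : nat -> {RV P >-> borelType G}) : Prop :=
  forall (J : {fset nat}) (B : nat -> set (borelType G)),
    (forall j, measurable (B j)) ->
    P (\bigcap_(j in [set` J]) (Y j @^-1` B j)) =
      (\prod_(j <- J) P (Y j @^-1` B j))%E.

Definition iid_law (mu : probability (borelType G) R) d
    (Omega : measurableType d) (P : probability Omega R)
    (Y : nat -> {RV P >-> borelType G}) : Prop :=
  independent_rvs Y /\
  forall n (B : set (borelType G)), measurable B -> distribution P (Y n) B = mu B.

(* Y k is the step Y_{k+1} *)
Fixpoint walk d (Omega : measurableType d) (P : probability Omega R)
    (Y : nat -> {RV P >-> borelType G}) (x : X) (n : nat) (w : Omega) : X :=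
  if n is k.+1 then act (Y k w) (walk Y x k w) else x.

(* The law P_x is that of the walk driven by any i.i.d. sequence of law mu;
   `almost surely' makes sense for neighborhoods that are not Borel. *)
Definition topologically_Harris_recurrent (mu : probability (borelType G) R)
    : Prop :=
  forall d (Omega : measurableType d) (P : probability Omega R)
    (Y : nat -> {RV P >-> borelType G}), iid_law mu Y ->
  forall (x : X) (B : set X), nbhs x B ->
    {ae P, forall w, lim_sup_set (fun n => [set w | B (walk Y x n w)]) w}.

End RandomWalk.

(* Main.v *)
From HB Require Import structures.
Require Import Defs.
From mathcomp Require Import all_boot all_order all_algebra.
From mathcomp Require Import finmap.
From mathcomp Require Import all_classical all_reals all_analysis.
From mathcomp Require Import measurable_realfun ring lra.

(** Write [P f x] for the mean of [f (g x)] when [g] has law [mu]; this is [avg].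
   As [mX] is invariant and [mu] symmetric, [P] is symmetric for [mX]
   ([walk_reversible]).  Fix a bounded open set [B] and let [h x] be the
   probability that the walk started at [x] ever visits [B] ([hitting]).  It
   satisfies [h = 1] on [B], [h = P h] off [B], and [P h <= h] everywhere.  The
   proof shows [h = 1] at every point.

   Potential theory gives [P h = h] almost everywhere.  On [B], [1 - P h] is
   the probability to leave [B] for ever, and its integral over [B] is at most
   the capacity of [B].  By the Cauchy-Schwarz inequality for the Dirichlet
   form, this capacity is controlled by the energy of any integrable function
   that is [1] on [B] ([capacity_step], [no_escape]).  Under quadratic growth
   there are such functions of arbitrarily small energy: averages of cut-offs
   at [L] geometric scales, each of bounded energy, and whose gradients are
   disjointly supported ([exists_cutoff]).  The compactness of the support of
   [mu] enters here: one step changes the word distance by a bounded amount.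

   Let [O] be the open set of the points near which [h = 1] almost everywhere.
   It contains [B].  Since [P h = h], Fubini's theorem shows that [O] is stable
   under the support of [mu]; the stabilizer of an open set is a closed
   subgroup, so that [O] is the whole space when [mu] is adapted.  Hence
   [h = 1] almost everywhere ([propagation]).

   To reach every point, iterate [P h <= h]: the value [h x] is at least the
   mean of [h (g x)] for the law [mu^*n].  The set of the [g] with [h (g x) < 1]
   is Haar-null ([haar_null_orbit]), and since [mu] is spread out, Haar-null
   sets have [mu^*n]-measure at most [1 - d] for some [d > 0].  Thus
   [inf h >= 1 - (1 - inf h) (1 - d)], whence [h = 1] ([superharmonic_eq1]).

   Finally, if [B] is visited almost surely from every point, it is visited
   almost surely after every time, by the Markov property ([ae_recurrent]).
   The latter has to be derived from the independence of the steps, which is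
   given on rectangles only ([law_pair]). *)

Set Implicit Arguments.
Unset Strict Implicit.
Unset Printing Implicit Defensive.

Import Order.TTheory GRing.Theory Num.Theory.
Import numFieldNormedType.Exports.

Local Open Scope classical_set_scope.
Local Open Scope ring_scope.

(** * Second countability and Borel sets *)

Lemma countable_base (T : topologicalType) : @second_countable T ->
  exists b : nat -> set T, (forall n, open (b n)) /\
    forall (x : T) (A : set T), nbhs x A -> exists2 n, b n x & b n `<=` A.
Proof.
move=> [B /countable_injP[e einj] [Bo Bnbhs]].
(* As [e] is injective, this union has at most one term. *)
pose b n := \bigcup_(V in [set V | B V /\ e V = n]) V.
have bE V : B V -> b (e V) = V.
  move=> BV; apply/seteqP; split=> x; last by exists V.
  by move=> [W [BW eWV]] Wx; rewrite -(einj _ _ _ _ eWV) ?inE.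
exists b; split=> [n|x A /Bnbhs [V [BV Vx] VA]].
  by apply: bigcup_open => V [/Bo].
by exists (e V); rewrite bE.
Qed.

Lemma open_measurable_borel (T : ptopologicalType) (U : set (borelType T)) :
  open (U : set T) -> measurable U.
Proof. exact: sub_sigma_algebra. Qed.

Lemma closed_measurable_borel (T : ptopologicalType) (U : set (borelType T)) :
  closed (U : set T) -> measurable U.
Proof.
by move=> /closed_openC/open_measurable_borel/measurableC; rewrite setCK.
Qed.

Lemma continuous_measurable_borel (S T : ptopologicalType) (f : S -> T) :
  continuous f -> measurable_fun [set: borelType S] (f : borelType S -> borelType T).
Proof.
move=> /continuousP fc.
apply: (@measurability _ _ (borelType S) (borelType T) _ _ (@open T)) => // _ [U oU <-].
by rewrite setTI; apply: open_measurable_borel; exact: fc.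
Qed.

(** Second countability makes an open subset of a product a countable union of
   open rectangles, hence a member of the product of the Borel sigma-algebras:
   without it, this product can be strictly smaller. *)
Lemma continuous_measurable_prod (S T Z : ptopologicalType) (f : S * T -> Z) :
  @second_countable S -> @second_countable T -> continuous f ->
  measurable_fun [set: borelType S * borelType T]
    (f : borelType S * borelType T -> borelType Z).
Proof.
move=> /countable_base[a [ao anbhs]] /countable_base[b [bo bnbhs]] /continuousP fc.
apply: (@measurability _ _ (borelType S * borelType T)%type (borelType Z) _ _
  (@open Z)) => // _ [U oU <-]; rewrite setTI.
pose D := [set ij : nat * nat | a ij.1 `*` b ij.2 `<=` f @^-1` U].
have -> : f @^-1` U = \bigcup_(ij in D) (a ij.1 `*` b ij.2).
  apply/seteqP; split=> [[x y] Ufxy|[x y] [ij Dij] /Dij //].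
  have := fc _ oU; rewrite openE => /(_ _ Ufxy)[[V W]/= [nV nW] VW].
  have [i aix aiV] := anbhs _ _ nV; have [j bjy bjW] := bnbhs _ _ nW.
  by exists (i, j) => //= -[x' y'] [/= /aiV ? /bjW ?]; apply: VW.
rewrite bigcup_mkcond; apply: countable_bigcupT_measurable => // ij.
case: ifPn => // _; apply: measurableX; exact: open_measurable_borel.
Qed.

Lemma metrizable_hausdorff (R : realType) (T : topologicalType) :
  metrizable R T -> hausdorff_space T.
Proof.
move=> [d [d0 dC dT dnbhs]] x y clxy; apply/d0/eqP.
have dge0 u v : 0 <= d u v.
  by have := dT u v u; rewrite (d0 u u).2 // (dC v u); lra.
rewrite eq_le dge0 andbT; apply/ler_addgt0Pr => e e0; rewrite add0r.
have bx z : nbhs z [set u | d z u < e / 2].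
  by apply/dnbhs; exists (e / 2) => //; lra.
have [z [/= xz yz]] := clxy _ _ (bx x) (bx y).
by have := dT x z y; rewrite (dC z y); lra.
Qed.

(** For each radius [1/(k+1)], finitely many balls cover each of the countably
   many compact sets; together these balls form a basis. *)
Lemma metrizable_sigma_compact_second_countable (R : realType) (T : ptopologicalType) :
  metrizable R T -> sigma_compact T -> @second_countable T.
Proof.
move=> [d [d0 dC dT dnbhs]] [K Kc KT].
pose f (k : nat) (z : T) : set T := [set u | d z u < k.+1%:R^-1]°.
have fz k z : f k z z.
  by rewrite /f; apply/dnbhs; exists k.+1%:R^-1.
have cov n k : finite_subset_cover [set: T] (f k) (K n).
  have := Kc n; rewrite compact_cover; apply => // [z _|z _]; first exact: open_interior.
  by exists z.
pose h n k := projT1 (cid2 (cov n k)).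
have hP n k : K n `<=` cover [set` h n k] (f k).
  by rewrite /h; case: cid2.
exists (\bigcup_n \bigcup_k (f k @` [set` h n k])).
  apply: bigcup_countable => // n _; apply: bigcup_countable => // k _.
  exact/finite_set_countable/finite_image/finite_fset.
split=> [_ [n _ [k _ [z _ <-]]]|x A /dnbhs[e e0 eA]]; first exact: open_interior.
have [k _ ke] : exists2 k : nat, True & k.+1%:R^-1 < e / 2.
  have [//|k] := @ltr_add_invr R 0 (e / 2) _; first by lra.
  by rewrite add0r; exists k.
have [n _ Knx] : (\bigcup_n K n) x by rewrite KT.
have [z hz fzx] := hP n k _ Knx.
exists (f k z); first by split=> //; exists n => //; exists k => //; exists z.
move=> y /interior_subset /= zy; apply: eA => /=.
have zx : d z x < e / 2 := lt_trans (interior_subset fzx) ke.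
have zye : d z y < e / 2 := lt_trans zy ke.
by have := dT x z y; rewrite (dC x z); lra.
Qed.

Lemma second_countable_image (S T : topologicalType) (f : S -> T) :
  continuous f -> (forall A, open A -> open (f @` A)) -> range f = setT ->
  @second_countable S -> @second_countable T.
Proof.
move=> fc fo fT [B Bcount [Bo Bnbhs]].
exists [set f @` b | b in B]; first exact: sub_countable (card_image_le _ _) Bcount.
split=> [_ [b Bb <-]|x A xA]; first exact/fo/Bo.
have [z _ zx] : range f x by rewrite fT.
have : nbhs z (f @^-1` A) by apply: fc; rewrite zx.
move=> /Bnbhs[V [BV Vz] VA]; exists (f @` V).
  by split; [exists V|exists z].
by move=> _ [u /VA ? <-].
Qed.

(** * Topological groups and their coset spaces *)

Section TopologicalGroup.
Variable G : topologicalGroupType.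
Implicit Types g h : G.

Lemma mulgl_continuous g : continuous (fun h => g * h)%g.
Proof.
move=> h; apply: (@continuous_comp _ _ _ (fun h => (g, h)) (fun p : G * G => p.1 * p.2)%g).
  by apply: cvg_pair => //; exact: cvg_cst.
exact: mulg_continuous.
Qed.

Lemma mulgr_continuous g : continuous (fun h => h * g)%g.
Proof.
move=> h; apply: (@continuous_comp _ _ _ (fun h => (h, g)) (fun p : G * G => p.1 * p.2)%g).
  by apply: cvg_pair => //; exact: cvg_cst.
exact: mulg_continuous.
Qed.

Lemma open_mulgr g (A : set G) : open A -> open [set h * g | h in A]%g.
Proof.
move=> oA; have -> : [set h * g | h in A]%g = (fun h => h * g^-1)%g @^-1` A.
  apply/seteqP; split=> [_ [h Ah <-]|h Ah] /=; first by rewrite mulgK.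
  by exists (h * g^-1)%g => //; rewrite mulgVK.
by move/continuousP: (@mulgr_continuous g^-1%g); apply.
Qed.

End TopologicalGroup.

Section CosetSpace.
Local Open Scope quotient_scope.
Variables (G : topologicalGroupType) (Gamma : groupClosed G).
Local Notation X := (coset_space Gamma).
Local Notation act := (@coset_act G Gamma).

Lemma coset_actM (g h : G) : act (g * h)%g = act g \o act h.
Proof.
by apply/funext => x; rewrite [RHS](coset_actE _ g (h * repr x)%g) /coset_act mulgA.
Qed.

Lemma coset_act1 (x : X) : act 1%g x = x.
Proof. by rewrite /coset_act mul1g reprK. Qed.

Lemma coset_act_transitive (x y : X) : exists g : G, act g x = y.
Proof.
exists (repr y * (repr x)^-1)%g.
by rewrite /coset_act mulgVK reprK.
Qed.

(** The saturation of [A] is the union of its translates by [Gamma] on the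
   right. *)
Lemma open_coset_pi (A : set G) : open A -> open (\pi_X @` A).
Proof.
move=> oA; rewrite /open /= /quotient_open.
have -> : \pi_X @^-1` (\pi_X @` A) =
    \bigcup_(c in [set` Gamma]) [set h * c | h in A]%g.
  apply/seteqP; split=> [y [a Aa /eqmodP ay]|_ [c cG [a Aa <-]]] /=.
    by exists (a^-1 * y)%g => //; exists a => //; rewrite mulVKg.
  by exists a => //; apply/eqmodP; rewrite /= /lcoset_rel mulKg.
by apply: bigcup_open => c _; exact: open_mulgr.
Qed.

Lemma coset_space_second_countable : @second_countable G -> @second_countable X.
Proof.
apply: (second_countable_image (f := \pi_X)) => [||].
- exact: pi_continuous.
- exact: open_coset_pi.
- by apply/seteqP; split => // x _; exists (repr x) => //; exact: reprK.
Qed.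

(** As the projection is open, it maps a product neighborhood upstairs to a
   product neighborhood downstairs. *)
Lemma coset_act_continuous : continuous (fun p : G * X => act p.1 p.2).
Proof.
move=> [g x] /= U nU.
have : nbhs (g, repr x) ((fun p : G * G => \pi_X (p.1 * p.2)%g) @^-1` U).
  apply: (@continuous_comp _ _ _ (fun p : G * G => p.1 * p.2)%g (\pi_X)) => //.
    exact: mulg_continuous.
  exact: pi_continuous.
move=> [[V W] /= [nV]]; rewrite nbhsE => -[W' [oW' xW'] W'W] VW.
exists (V, \pi_X @` W') => /=; first split => //.
  apply: open_nbhs_nbhs; split; first exact: open_coset_pi.
  by exists (repr x) => //; exact: reprK.
move=> [g' _] /= [Vg' [h /W'W Wh <-]].
by rewrite coset_actE; exact: (VW (g', h)).
Qed.

Lemma open_coset_orbit (x : X) (A : set G) : open A -> open [set act g x | g in A].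
Proof.
move=> oA; have -> : [set act g x | g in A] =
    \pi_X @` [set g * repr x | g in A]%g by rewrite image_comp.
by apply: open_coset_pi; exact: open_mulgr.
Qed.

End CosetSpace.

(** * Reversible random walks *)

Section UnitFun.
Context d (T : measurableType d) (R : realType).
Implicit Types (f g : T -> R) (A : set T).

(** For such functions all the means below are finite, so that they can be
   real-valued. *)
Definition unit_fun f := measurable_fun [set: T] f /\ forall x, 0 <= f x <= 1.

Lemma unit_fun_cst1 : unit_fun (cst 1).
Proof. by split=> [|x]; [exact: measurable_cst|rewrite /cst lexx ler01]. Qed.

Lemma unit_fun_indic A : measurable A -> unit_fun \1_A.
Proof.
move=> mA; split=> [|x]; first exact: measurable_indic.
by rewrite indicE; case: (x \in A); rewrite ?lexx ler01.
Qed.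

Lemma unit_funM f g : unit_fun f -> unit_fun g -> unit_fun (fun x => f x * g x).
Proof.
move=> [mf f01] [mg g01]; split=> [|x]; first exact: measurable_funM.
by have := f01 x; have := g01 x; nra.
Qed.

Lemma unit_fun_sqrB f g :
  unit_fun f -> unit_fun g -> unit_fun (fun x => (f x - g x) ^+ 2).
Proof.
move=> [mf f01] [mg g01]; split=> [|x].
  by apply: measurable_funX; exact: measurable_funB.
have /andP[f0 f1] := f01 x; have /andP[g0 g1] := g01 x.
have fg1 : 0 <= (1 - (f x - g x)) * (1 + (f x - g x)) by apply: mulr_ge0; lra.
by rewrite sqr_ge0 /=; nra.
Qed.

Lemma unit_fun_integrable (P : probability T R) f :
  unit_fun f -> P.-integrable [set: T] (EFin \o f).
Proof.
move=> [mf f01]; apply: measurable_bounded_integrable => //.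
  by apply: le_lt_trans (probability_le1 P measurableT) _; rewrite ltry.
exists 1; split => // M M1 x _ /=; apply: le_trans (ltW M1).
by have /andP[f0 f1] := f01 x; rewrite ger0_norm.
Qed.

Lemma Rintegral_probability1 (P : probability T R) : \int[P]_x (cst 1 : T -> R) x = 1.
Proof. by rewrite Rintegral_cst // mul1r; exact: (congr1 fine (probability_setT P)). Qed.

Lemma Rintegral_unit_fun (P : probability T R) f :
  unit_fun f -> 0 <= \int[P]_x f x <= 1.
Proof.
move=> uf; have [mf f01] := uf; apply/andP; split.
  by apply: Rintegral_ge0 => x _; case/andP: (f01 x).
rewrite -[leRHS](Rintegral_probability1 P).
apply: le_Rintegral => //; first exact: unit_fun_integrable.
  exact/unit_fun_integrable/unit_fun_cst1.
by move=> x _; case/andP: (f01 x).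
Qed.

Lemma Rintegral_unit_funE (P : probability T R) f :
  unit_fun f -> (\int[P]_x f x)%:E = (\int[P]_x (f x)%:E)%E.
Proof.
by move=> uf; rewrite fineK //; apply: integrable_fin_num => //; exact: unit_fun_integrable.
Qed.

Lemma unit_fun_mean1 (P : probability T R) f :
  unit_fun f -> \int[P]_x f x = 1 -> P [set x | f x < 1] = 0%E.
Proof.
move=> uf I1; have [mf f01] := uf; have u1 := unit_fun_cst1.
have mv : measurable_fun [set: T] (fun x => (1 - f x)%:E).
  by apply/measurable_EFinP; exact: measurable_funB.
have I0 : (\int[P]_x `|(1 - f x)%:E| = 0)%E.
  transitivity (\int[P]_x ((cst 1 x)%:E - (f x)%:E))%E.
    by apply: eq_integral => x _; rewrite gee0_abs // lee_fin subr_ge0; case/andP: (f01 x).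
  rewrite integralB_EFin //; [|exact: unit_fun_integrable..].
  by rewrite -!Rintegral_unit_funE // I1 Rintegral_probability1 subee.
have mN : measurable [set x | f x < 1].
  by rewrite -[X in measurable X]setTI; apply: measurable_fun_ltr.
have [N [mN' N0 fN]] := (ae_eq_integral_abs P measurableT mv).1 I0.
apply: (subset_measure0 mN mN' _ N0) => x /= fx; apply: fN => /= /(_ I)[].
by move=> /eqP; rewrite subr_eq0 => /eqP fx1; move: fx; rewrite -fx1 ltxx.
Qed.

End UnitFun.

Lemma unit_fun_comp d d' (S : measurableType d) (T : measurableType d') (R : realType)
    (f : T -> R) (g : S -> T) :
  measurable_fun [set: S] g -> unit_fun f -> unit_fun (f \o g).
Proof. by move=> mg [mf f01]; split=> [|x]; [exact: measurableT_comp|exact: f01]. Qed.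

Lemma unit_fun_section d d' (S : measurableType d) (X : measurableType d') (R : realType)
    (K : S * X -> R) (x : X) :
  unit_fun K -> unit_fun (fun g => K (g, x)).
Proof. by apply: unit_fun_comp; exact: pair2_measurable. Qed.

Lemma unit_fun_Rintegral d d' (S : measurableType d) (X : measurableType d')
    (R : realType) (P : probability S R) (K : S * X -> R) :
  unit_fun K -> unit_fun (fun x => \int[P]_g K (g, x)).
Proof.
move=> uK; have [mK K01] := uK; split=> [|x]; last first.
  by apply: Rintegral_unit_fun; exact: unit_fun_section.
apply: (@measurableT_comp _ _ _ _ _ _ fine); first exact: fine_measurable.
apply: (measurable_fun_fubini_tonelli_G (m1 := P) (EFin \o K)).
  exact/measurable_EFinP.
by move=> x; rewrite lee_fin; case/andP: (K01 x).
Qed.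

(** Listing the terms makes it possible to integrate an inequality with many
   terms at once. *)
Lemma Rintegral_lincomb d (T : measurableType d) (R : realType)
    (m : {measure set T -> \bar R}) (s : seq (R * (T -> R))) :
  all (fun p => m.-integrable [set: T] (EFin \o p.2)) s ->
  m.-integrable [set: T] (EFin \o (fun x => \sum_(p <- s) p.1 * p.2 x)) /\
  \int[m]_x (\sum_(p <- s) p.1 * p.2 x) = \sum_(p <- s) p.1 * \int[m]_x p.2 x.
Proof.
elim: s => [_|[c f] s IH /= /andP[intf /IH[ints sE]]].
  rewrite (_ : (fun x => _) = cst 0); last by apply/funext => x; rewrite big_nil.
  by rewrite big_nil Rintegral_cst // mul0r; split=> //; exact: integrable0.
have intcf : m.-integrable [set: T] (EFin \o (fun x => c * f x)).
  exact: (integrableZl measurableT c intf).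
rewrite (_ : (fun x => _) = fun x => c * f x + \sum_(p <- s) p.1 * p.2 x); last first.
  by apply/funext => x; rewrite big_cons.
split; first exact: (integrableD measurableT intcf ints).
by rewrite RintegralD // big_cons /= sE RintegralZl.
Qed.

Section RandomMaps.
Context d d' (S : measurableType d) (X : measurableType d') (R : realType).
Variables (mu : probability S R) (act : S -> X -> X).
Hypothesis act_meas : measurable_fun [set: S * X] (fun p => act p.1 p.2).
Implicit Types f h : X -> R.

(** The Markov operator of the walk [x |-> g x]. *)
Definition avg f (x : X) : R := \int[mu]_g f (act g x).

Lemma unit_fun_act f x : unit_fun f -> unit_fun (fun g => f (act g x)).
Proof.
move=> uf; apply: (@unit_fun_section _ _ _ _ _ (fun p => f (act p.1 p.2))).
exact: (unit_fun_comp act_meas uf).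
Qed.

Lemma unit_fun_avg f : unit_fun f -> unit_fun (avg f).
Proof.
move=> uf; apply: (@unit_fun_Rintegral _ _ _ _ _ _ (fun p => f (act p.1 p.2))).
exact: (unit_fun_comp act_meas uf).
Qed.

Lemma avgE f x : unit_fun f -> (avg f x)%:E = (\int[mu]_g (f (act g x))%:E)%E.
Proof. by move=> uf; apply: Rintegral_unit_funE; exact: unit_fun_act. Qed.

Lemma le_avg f h x : unit_fun f -> unit_fun h -> (forall y, f y <= h y) ->
  avg f x <= avg h x.
Proof.
move=> uf uh fh.
have int k : unit_fun k -> mu.-integrable setT (EFin \o (fun g => k (act g x))).
  by move=> uk; apply: unit_fun_integrable; exact: unit_fun_act.
by apply: le_Rintegral => [//|||g _]; [exact: int|exact: int|exact: fh].
Qed.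

Lemma avg1 x : avg (cst 1) x = 1.
Proof. exact: Rintegral_probability1. Qed.

Variables (B : set X) (B_meas : measurable B).

(** [hit N x] is the probability to visit [B] at one of the times [0, .., N]
   when starting at [x]. *)
Fixpoint hit (N : nat) : X -> R :=
  if N is N'.+1 then fun x => \1_B x + \1_(~` B) x * avg (hit N') x else \1_B.

Lemma unit_fun_hit N : unit_fun (hit N).
Proof.
elim: N => [|N IH]; first exact: unit_fun_indic.
have [ma a01] := unit_fun_avg IH; split=> [|x] /=.
  apply: measurable_funD; first exact: measurable_indic.
  by apply: measurable_funM => //; exact/measurable_indic/measurableC.
have := a01 x; rewrite !indicE in_setC.
by case: (x \in B) => /=; rewrite ?(mul0r, mul1r, addr0, add0r, lexx, ler01).
Qed.

Lemma hit_in N x : B x -> hit N x = 1.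
Proof.
case: N => [|N] Bx /=; rewrite !indicE ?in_setC ?mem_set //=.
by rewrite mul0r addr0.
Qed.

Lemma hitS_out N x : ~ B x -> hit N.+1 x = avg (hit N) x.
Proof. by move=> Bx; rewrite /= !indicE in_setC memNset //= add0r mul1r. Qed.

Lemma le_hitS N x : hit N x <= hit N.+1 x.
Proof.
have [Bx|Bx] := pselect (B x); first by rewrite !hit_in.
elim: N x Bx => [|N IH] x Bx; rewrite hitS_out //.
  rewrite /= indicE memNset //=.
  by have [_ /(_ x)/andP[]] := unit_fun_avg (unit_fun_hit 0).
rewrite hitS_out //; apply: le_avg => [||y]; try exact: unit_fun_hit.
by have [By|/IH //] := pselect (B y); rewrite !hit_in.
Qed.

Lemma nondecreasing_hit x : {homo hit ^~ x : n m / (n <= m)%N >-> n <= m}.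
Proof. by apply: homo_leq => [//|n k m|n]; [exact: le_trans|exact: le_hitS]. Qed.

Definition hitting (x : X) : R := limn (hit ^~ x).

Lemma cvg_hit x : hit ^~ x @ \oo --> hitting x.
Proof.
apply: nondecreasing_is_cvgn; first exact: nondecreasing_hit.
by exists 1 => _ [n _ <-]; have [_ /(_ x)/andP[]] := unit_fun_hit n.
Qed.

Lemma le_hit_hitting N x : hit N x <= hitting x.
Proof.
by apply: nondecreasing_cvgn_le; [exact: nondecreasing_hit|exact: cvgP (@cvg_hit x)].
Qed.

Lemma unit_fun_hitting : unit_fun hitting.
Proof.
split=> [|x].
  apply: (measurable_fun_cvg (h := hit)) => [n|x _]; last exact: cvg_hit.
  by have [] := unit_fun_hit n.
have [_ /(_ x)/andP[h0 _]] := unit_fun_hit 0.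
rewrite (le_trans h0 (le_hit_hitting _ _)) /=.
apply: limr_le; first exact: cvgP (@cvg_hit x).
by near=> n; have [_ /(_ x)/andP[]] := unit_fun_hit n.
Unshelve. all: by end_near. Qed.

Lemma cvg_avg_hit x : avg (hit n) x @[n --> \oo] --> avg hitting x.
Proof.
apply: fine_cvg; rewrite -/(avg hitting x) avgE; last exact: unit_fun_hitting.
apply: (@dominated_cvg _ _ _ mu setT measurableT (fun n g => (hit n (act g x))%:E)
  (fun g => (hitting (act g x))%:E) (cst 1%E)) => //.
- by move=> n; apply/measurable_EFinP; have [] := unit_fun_act x (unit_fun_hit n).
- by move=> g _; apply: cvg_EFin; [exact: nearW|exact: cvg_hit].
- exact/unit_fun_integrable/unit_fun_cst1.
- move=> n g _; have [_ /(_ (act g x))/andP[h0 h1]] := unit_fun_hit n.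
  by rewrite /= lee_fin ger0_norm.
Qed.

Lemma hittingE x : hitting x = \1_B x + \1_(~` B) x * avg hitting x.
Proof.
apply: (@cvg_unique _ _ (hit n.+1 x @[n --> \oo])) => //.
  by have := @cvg_hit x; rewrite -(cvg_shiftS (hit ^~ x)).
apply: cvgD; first exact: cvg_cst.
by apply: cvgM; [exact: cvg_cst|exact: cvg_avg_hit].
Qed.

Lemma hitting_in x : B x -> hitting x = 1.
Proof.
by move=> Bx; rewrite hittingE !indicE in_setC mem_set //= mul0r addr0.
Qed.

Lemma avg_hitting_le x : avg hitting x <= hitting x.
Proof.
have [_ /(_ x)/andP[_ a1]] := unit_fun_avg unit_fun_hitting.
have [Bx|Bx] := pselect (B x); first by rewrite hitting_in.
by rewrite [leRHS]hittingE !indicE in_setC memNset //= add0r mul1r.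
Qed.

Variable m : {measure set X -> \bar R}.
Hypothesis reversible : forall f h, unit_fun f -> unit_fun h ->
  (\int[m]_x (f x * avg h x)%:E)%E = (\int[m]_x (avg f x * h x)%:E)%E.

Local Notation int f := (m.-integrable [set: X] (EFin \o f)).
Local Notation J f := (\int[m]_x (f x)).

Lemma dominated_int f h : measurable_fun [set: X] f ->
  (forall x, 0 <= f x <= h x) -> int h -> int f.
Proof.
move=> mf fh; apply: le_integrable => //; first exact/measurable_EFinP.
move=> x _; have /andP[f0 fhx] := fh x.
by rewrite /= lee_fin !ger0_norm // (le_trans f0).
Qed.

Lemma integral_avg f : unit_fun f ->
  (\int[m]_x (avg f x)%:E)%E = (\int[m]_x (f x)%:E)%E.
Proof.
move=> uf; have := reversible (unit_fun_cst1 X R) uf; under eq_integral do rewrite mul1r.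
by move=> ->; apply: eq_integral => x _; rewrite avg1 mul1r.
Qed.

Lemma unit_fun_intP f : unit_fun f -> int f <-> (\int[m]_x (f x)%:E < +oo)%E.
Proof.
move=> [mf f01]; have E : (\int[m]_x `|(f x)%:E| = \int[m]_x (f x)%:E)%E.
  by apply: eq_integral => x _; rewrite gee0_abs // lee_fin; case/andP: (f01 x).
split=> [/integrableP[_]|foo]; first by rewrite E.
by apply/integrableP; split; [exact/measurable_EFinP|rewrite E].
Qed.

Lemma int_avg f : unit_fun f -> int f -> int (avg f).
Proof.
move=> uf; rewrite !unit_fun_intP ?integral_avg //; exact: unit_fun_avg.
Qed.

(** The integral of [energy f] is twice the Dirichlet form of [f]. *)
Definition energy f (x : X) : R := \int[mu]_g (f (act g x) - f x) ^+ 2.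

Lemma unit_fun_energy f : unit_fun f -> unit_fun (energy f).
Proof.
move=> uf; apply: (@unit_fun_Rintegral _ _ _ _ _ _ (fun p => (f (act p.1 p.2) - f p.2) ^+ 2)).
apply: unit_fun_sqrB; first exact: (unit_fun_comp act_meas uf).
exact: (unit_fun_comp measurable_snd uf).
Qed.

Lemma unit_fun_energy_section f x : unit_fun f ->
  unit_fun (fun g => (f (act g x) - f x) ^+ 2).
Proof.
move=> uf; apply: (unit_fun_sqrB (g := cst (f x)) (unit_fun_act x uf)).
by split=> [|g]; [exact: measurable_cst|case: uf => _; exact].
Qed.

Lemma int_energy f : unit_fun f -> int f -> int (energy f).
Proof.
move=> uf intf; have [me e01] := unit_fun_energy uf; have [_ f01] := uf.
apply: (@dominated_int _ (fun x => avg f x + f x)) => // [x|]; last first.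
  exact: (integrableD measurableT (int_avg uf intf) intf).
have /andP[-> _ /=] := e01 x.
have i1 : mu.-integrable [set: S] (EFin \o (fun g => f (act g x))).
  by apply: unit_fun_integrable; exact: unit_fun_act.
have i2 : mu.-integrable [set: S] (EFin \o (fun=> f x)).
  apply: unit_fun_integrable; split=> [|g]; [exact: measurable_cst|exact: f01].
have -> : avg f x + f x = \int[mu]_g (f (act g x) + f x).
  rewrite RintegralD // Rintegral_cst //; congr (_ + _).
  by rewrite (_ : fine _ = 1) ?mulr1 //; exact: (congr1 fine (probability_setT mu)).
apply: le_Rintegral => // [||g _]; last by have := f01 x; have := f01 (act g x); nra.
  by apply: unit_fun_integrable; exact: unit_fun_energy_section.
exact: (integrableD measurableT i1 i2).
Qed.

Lemma Rintegral_avg f : unit_fun f -> J (avg f) = J f.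
Proof. by move=> uf; rewrite /Rintegral integral_avg. Qed.

(** The mean over [g] of
   [(2 * t)^-1 * (t * (h x - h (g x)) - (f x - f (g x))) ^+ 2]. *)
Lemma energy_ineq_pointwise f h (t : R) x : unit_fun f -> unit_fun h -> 0 < t ->
  0 <= h x * avg f x + f x * avg h x + t / 2 * (h x * h x)
     + t / 2 * avg (fun y => h y * h y) x + (2 * t)^-1 * energy f x
     - h x * f x - avg (fun y => h y * f y) x - t * (h x * avg h x).
Proof.
move=> uf uh t0.
pose s : seq (R * (S -> R)) := [:: (h x, fun g => f (act g x)); (f x, fun g => h (act g x));
  (t / 2 * (h x * h x) - h x * f x, cst 1);
  (t / 2, fun g => h (act g x) * h (act g x));
  ((2 * t)^-1, fun g => (f (act g x) - f x) ^+ 2);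
  (- 1, fun g => h (act g x) * f (act g x)); (- (t * h x), fun g => h (act g x))].
have iu k : unit_fun k -> mu.-integrable [set: S] (EFin \o k).
  exact: unit_fun_integrable.
have [|_ sE] := @Rintegral_lincomb _ _ _ mu s.
  rewrite /= !iu //; first [exact: unit_fun_act | exact: unit_fun_energy_section | idtac].
  - by apply: (@unit_fun_act (fun y => h y * f y)); exact: unit_funM.
  - by apply: (@unit_fun_act (fun y => h y * h y)); exact: unit_funM.
  - exact: unit_fun_cst1.
have : 0 <= \int[mu]_g (\sum_(p <- s) p.1 * p.2 g).
  apply: Rintegral_ge0 => g _; rewrite !big_cons big_nil /= /cst.
  set a := h x; set a' := h _; set b := f x; set b' := f _.
  rewrite (_ : _ + _ = (2 * t)^-1 * (t * (a - a') - (b - b')) ^+ 2).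
    by rewrite mulr_ge0 ?sqr_ge0 // invr_ge0 mulr_ge0 // ltW.
  by field; rewrite gt_eqF.
rewrite sE !big_cons big_nil /= Rintegral_probability1 /avg /energy.
by move/le_trans; apply; rewrite le_eqVlt; apply/orP; left; apply/eqP; ring.
Qed.

(** The inequality [2 * E(h, f) <= t * E(h, h) + t^-1 * E(f, f)] for the
   Dirichlet form [E(h, f) = J (h * f) - J (h * avg f)].  It comes from
   [energy_ineq_pointwise] since [avg] preserves integrals and is symmetric;
   the form [E(f, f)] is kept as an integral of increments. *)
Lemma energy_ineq f h (t : R) : unit_fun f -> unit_fun h -> int f -> int h -> 0 < t ->
  2 * J (fun x => h x * f x) + t * J (fun x => h x * avg h x) <=
  2 * J (fun x => f x * avg h x) + t * J (fun x => h x * h x)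
  + (2 * t)^-1 * J (energy f).
Proof.
move=> uf uh intf inth t0.
have uaf := unit_fun_avg uf; have uah := unit_fun_avg uh.
have uhf := unit_funM uh uf; have uhh := unit_funM uh uh.
have intM k l : unit_fun k -> unit_fun l -> int k -> int (fun x => k x * l x).
  move=> uk ul; apply: dominated_int; first by have [] := unit_funM uk ul.
  move=> x; have [[_ /(_ x) k01] [_ /(_ x) l01]] := (uk, ul); nra.
pose s : seq (R * (X -> R)) := [:: (1, fun x => h x * avg f x);
  (1, fun x => f x * avg h x); (t / 2, fun x => h x * h x);
  (t / 2, avg (fun y => h y * h y)); ((2 * t)^-1, energy f); (- 1, fun x => h x * f x);
  (- 1, avg (fun y => h y * f y)); (- t, fun x => h x * avg h x)].
have [|_ sE] := @Rintegral_lincomb _ _ _ m s.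
  by rewrite /= !intM ?int_avg ?int_energy ?intM.
have : 0 <= J (fun x => \sum_(p <- s) p.1 * p.2 x).
  apply: Rintegral_ge0 => x _; rewrite !big_cons big_nil /=.
  have := energy_ineq_pointwise x uf uh t0; lra.
have rhf : J (fun x => h x * avg f x) = J (fun x => f x * avg h x).
  rewrite /Rintegral reversible //; congr fine; apply: eq_integral => x _.
  by rewrite mulrC.
rewrite sE !big_cons big_nil /= rhf !Rintegral_avg //; lra.
Qed.

Section Capacity.
Hypothesis B_fin : (m B < +oo)%E.

Lemma int_indic : int (\1_B : X -> R).
Proof.
by apply/unit_fun_intP; [exact: unit_fun_indic|rewrite integral_indic // setIT].
Qed.

Lemma int_hit N : int (hit N).
Proof.
elim: N => [|N IH]; first exact: int_indic.
have := integrableD measurableT int_indic (int_avg (unit_fun_hit N) IH).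
apply: dominated_int; first by have [] := unit_fun_hit N.+1.
move=> x; have [_ /(_ x)/andP[-> _ /=]] := unit_fun_hit N.+1.
rewrite lerD2l indicE; have [_ /(_ x)/andP[a0 _]] := unit_fun_avg (unit_fun_hit N).
by case: (x \in _); rewrite ?mul1r ?mul0r.
Qed.

Let outside f n := J (fun x => \1_(~` B) x * (hit n x * f x)).

(** The energy inequality for [h = hit N].  On [B], [h = f = 1].  Off [B],
   [avg h = hit N.+1], so that [avg h] turns the outside pairing of rank [N]
   into that of rank [N.+1], and [h * h <= h * avg h] there, which bounds
   [E(h, h)] by the mass of [B]. *)
Lemma capacity_step f (t : R) N : unit_fun f -> int f -> (forall x, B x -> f x = 1) ->
  0 < t ->
  2 * J (\1_B : X -> R) + 2 * outside f N <=
  2 * J (fun x => \1_B x * avg hitting x) + 2 * outside f N.+1 +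
  t * J (\1_B : X -> R) + (2 * t)^-1 * J (energy f).
Proof.
move=> uf intf fB t0; set h := hit N.
have uh : unit_fun h by exact: unit_fun_hit.
have inth : int h by exact: int_hit.
have uah := unit_fun_avg uh; have uaH := unit_fun_avg unit_fun_hitting.
have ub : unit_fun (\1_B : X -> R) by exact: unit_fun_indic.
have intM k l : unit_fun k -> unit_fun l -> int k -> int (fun x => k x * l x).
  move=> uk ul; apply: dominated_int; first by have [] := unit_funM uk ul.
  move=> x; have [[_ /(_ x) k01] [_ /(_ x) l01]] := (uk, ul); nra.
have intc n : int (fun x => \1_(~` B) x * (hit n x * f x)).
  have uhn := unit_fun_hit n; have uc : unit_fun (\1_(~` B) : X -> R).
    exact/unit_fun_indic/measurableC.
  apply: (@dominated_int _ (fun x => hit n x * f x)); last exact/intM/int_hit.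
    by have [] := unit_funM uc (unit_funM uhn uf).
  move=> x; have [_ /(_ x) hf01] := unit_funM uhn uf; have [_ /(_ x) c01] := uc.
  nra.
have Jhf : J (fun x => h x * f x) = J (\1_B : X -> R) + outside f N.
  rewrite -RintegralD //; last exact: int_indic.
  apply: eq_Rintegral => x _; rewrite !indicE in_setC.
  have [Bx|Bx] := pselect (B x); last by rewrite memNset //= add0r mul1r.
  by rewrite /h hit_in // fB // mem_set //= mul0r addr0 mulr1.
have Jfa : J (fun x => f x * avg h x) = J (fun x => \1_B x * avg h x) + outside f N.+1.
  rewrite -RintegralD //; last exact/intM/int_indic.
  apply: eq_Rintegral => x _; rewrite !indicE in_setC.
  have [Bx|Bx] := pselect (B x).
    by rewrite fB // mem_set //= mul0r addr0.
  by rewrite memNset // hitS_out //= mul0r add0r mul1r mulrC.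
have Jhh : J (fun x => h x * h x) <= J (\1_B : X -> R) + J (fun x => h x * avg h x).
  rewrite -RintegralD //; [|exact: int_indic|exact: intM].
  apply: le_Rintegral => // [||x _]; first exact: intM.
    exact: (integrableD measurableT int_indic (intM _ _ uh uah inth)).
  have [_ /(_ x) h01] := uh; have [_ /(_ x) a01] := uah; rewrite indicE.
  have [Bx|Bx] := pselect (B x); first by rewrite mem_set //=; nra.
  by rewrite memNset //= add0r -hitS_out // ler_wpM2l ?le_hitS //; case/andP: h01.
have JH : J (fun x => \1_B x * avg h x) <= J (fun x => \1_B x * avg hitting x).
  apply: le_Rintegral => // [||x _]; try exact/intM/int_indic.
  rewrite ler_wpM2l ?indicE //; apply: le_avg => //; first exact: unit_fun_hitting.
  by move=> y; exact: le_hit_hitting.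
have := energy_ineq uf uh intf inth t0; rewrite Jhf Jfa.
have := ler_wpM2l (ltW t0) Jhh; lra.
Qed.

Hypothesis test : forall e : R, 0 < e -> exists f : X -> R,
  [/\ unit_fun f, int f, forall x, B x -> f x = 1 & J (energy f) <= e].

(** By [capacity_step], the bounded sequence [outside f] increases at each step
   by at least some constant, which is therefore nonpositive.  For [f] of energy
   [t ^+ 2] and [t] tending to [0], this constant tends to the difference of
   the two sides. *)
Lemma no_escape : J (\1_B : X -> R) <= J (fun x => \1_B x * avg hitting x).
Proof.
set b := J (\1_B : X -> R); set q := J _.
have b0 : 0 <= b by rewrite /b; apply: Rintegral_ge0 => x _; rewrite indicE.
have key (t : R) : 0 < t -> b - q <= t * (b / 2 + 4^-1).
  move=> t0; have [|f [uf intf fB ft]] := test (e := t ^+ 2); first exact: exprn_gt0.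
  pose c := b - q - t * (b / 2 + 4^-1).
  have betaS N : c <= outside f N.+1 - outside f N.
    have := capacity_step N uf intf fB t0; rewrite -/b -/q.
    have : (2 * t)^-1 * J (energy f) <= t / 2.
      apply: le_trans (_ : (2 * t)^-1 * t ^+ 2 <= _).
        by rewrite ler_wpM2l // invr_ge0 mulr_ge0 // ltW.
      by rewrite le_eqVlt; apply/orP; left; apply/eqP; field; rewrite gt_eqF.
    by rewrite /c; lra.
  have beta_ge N : N%:R * c <= outside f N.
    elim: N => [|N IH]; last by have := betaS N; rewrite -natr1 mulrDl mul1r; lra.
    rewrite mul0r; apply: Rintegral_ge0 => x _.
    have [_ /(_ x) hf01] := unit_funM (unit_fun_hit 0) uf.
    by rewrite mulr_ge0 ?indicE //; case/andP: hf01.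
  have beta_le N : outside f N <= J f.
    have uc : unit_fun (\1_(~` B) : X -> R) by exact/unit_fun_indic/measurableC.
    have [mg g01] := unit_funM uc (unit_funM (unit_fun_hit N) uf).
    have gf x : 0 <= \1_(~` B) x * (hit N x * f x) <= f x.
      have [_ /(_ x) h01] := unit_fun_hit N; have [_ /(_ x) f01] := uf.
      have [_ /(_ x) c01] := uc.
      have hf : 0 <= hit N x * f x <= f x by nra.
      by apply/andP; split; nra.
    apply: le_Rintegral => // [|x _]; first exact: dominated_int gf intf.
    by case/andP: (gf x).
  rewrite -subr_le0 -/c leNgt; apply/negP => c0.
  have [N] : exists N : nat, J f / c < N%:R.
    by eexists; exact: truncnS_gt.
  rewrite ltr_pdivrMr //; have := beta_ge N; have := beta_le N; lra.
rewrite -subr_le0; apply/ler_addgt0Pr => e e0; rewrite add0r.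
have d0 : 0 < b / 2 + 4^-1 by lra.
by have := key (e / (b / 2 + 4^-1)) (divr_gt0 e0 d0); rewrite divfK // gt_eqF.
Qed.

(** Off [B], this is the recursion that defines [hit]; on [B], where [hitting]
   is [1] and [avg hitting] at most [1], this is [no_escape]. *)
Lemma ae_avg_hitting : {ae m, forall x, avg hitting x = hitting x}.
Proof.
have ua := unit_fun_avg unit_fun_hitting; have [ma a01] := ua.
pose u x : R := \1_B x * (1 - avg hitting x).
have u0 x : 0 <= u x by rewrite mulr_ge0 ?indicE // subr_ge0; case/andP: (a01 x).
have mu' : measurable_fun [set: X] u.
  apply: measurable_funM; first exact: measurable_indic.
  exact: measurable_funB.
have intu : int u.
  apply: dominated_int int_indic => // x; rewrite u0 /= ler_piMr ?indicE //.
  by have := a01 x; lra.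
have intba : int (fun x => \1_B x * avg hitting x).
  apply: dominated_int int_indic => [|x].
    by apply: measurable_funM => //; exact: measurable_indic.
  have := a01 x; rewrite indicE; case: (x \in B) => /=; lra.
have Ju : J u = 0.
  apply/eqP; rewrite eq_le; apply/andP; split; last by apply: Rintegral_ge0 => x _.
  have -> : J u = J (\1_B : X -> R) - J (fun x => \1_B x * avg hitting x).
    rewrite -RintegralB //; last exact: int_indic.
    by apply: eq_Rintegral => x _; rewrite /u mulrBr mulr1.
  by rewrite subr_le0 no_escape.
have Iu : (\int[m]_x `|(u x)%:E| = 0)%E.
  under eq_integral do rewrite gee0_abs ?lee_fin //.
  rewrite -[LHS]fineK; first by rewrite -/(Rintegral m setT u) Ju.
  exact: integrable_fin_num.
have /(ae_eq_integral_abs m measurableT) : measurable_fun [set: X] (EFin \o u).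
  exact/measurable_EFinP.
move=> -[/(_ Iu) [N [mN N0 uN]] _]; exists N; split=> // x /= Nx.
apply: uN => /= ux; apply: Nx; move: (ux I) => [].
rewrite hittingE /u indicE indicE in_setC.
by case: (x \in B) => /=; rewrite ?mul1r ?mul0r ?addr0 ?add0r //; lra.
Qed.

End Capacity.
End RandomMaps.

(** * Recursions driven by independent variables *)

Section LawOn.
Context d d' (Omega : measurableType d) (T : measurableType d') (R : realType).
Variables (P : probability Omega R) (W : set Omega) (f : Omega -> T).
Hypotheses (mW : measurable W) (mf : measurable_fun [set: Omega] f).

(** Unnormalized conditioning on [W]: this avoids dividing by [P W], which may
   vanish.  The measurability of [f] is an argument so that the measure
   structure below can be inferred. *)
Definition law_on of measurable_fun [set: Omega] f : set T -> \bar R :=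
  pushforward (mrestr P mW) f.

Let law_on0 : law_on mf set0 = 0%E. Proof. exact: measure0. Qed.

Let law_on_ge0 A : (0 <= law_on mf A)%E. Proof. exact: measure_ge0. Qed.

Let law_on_sigma_additive : semi_sigma_additive (law_on mf).
Proof. exact: measure_semi_sigma_additive. Qed.

HB.instance Definition _ := isMeasure.Build _ _ _ (law_on mf)
  law_on0 law_on_ge0 law_on_sigma_additive.

Let law_on_fin : fin_num_fun (law_on mf).
Proof.
move=> A mA; apply: (fin_num_measure P); apply: measurableI => //.
by rewrite -[_ @^-1` _]setTI; exact: mf.
Qed.

HB.instance Definition _ := Measure_isFinite.Build _ _ _ (law_on mf) law_on_fin.

Lemma law_onE A : law_on mf A = P (f @^-1` A `&` W).
Proof. by []. Qed.

End LawOn.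

Lemma integral_law_onT d d' (Omega : measurableType d) (T : measurableType d')
    (R : realType) (P : probability Omega R) (f : Omega -> T)
    (mf : measurable_fun [set: Omega] f) (h : T -> \bar R) :
  measurable_fun [set: T] h -> (forall y, 0 <= h y)%E ->
  (\int[law_on P measurableT mf]_y h y = \int[P]_w h (f w))%E.
Proof.
move=> mh h0; have -> : (\int[P]_w h (f w) = \int[pushforward P f]_y h y)%E.
  by rewrite ge0_integral_pushforward.
apply: eq_measure_integral => A mA _ /=.
by rewrite law_onE setIT.
Qed.

Section Driven.
Context d d1 d2 (Omega : measurableType d) (S : measurableType d1) (Z : measurableType d2).
Variables (R : realType) (P : probability Omega R) (mu : probability S R).
Variables (Y : nat -> Omega -> S) (step : nat -> S -> Z -> Z) (z0 : Z).
Hypothesis mY : forall k, measurable_fun [set: Omega] (Y k).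
Hypothesis indep : forall (J : {fset nat}) (B : nat -> set S),
  (forall j, measurable (B j)) ->
  P (\bigcap_(j in [set` J]) (Y j @^-1` B j)) = (\prod_(j <- J) mu (B j))%E.
Hypothesis mstep : forall k, measurable_fun [set: S * Z] (fun p => step k p.1 p.2).

Fixpoint driven (n : nat) (w : Omega) : Z :=
  if n is k.+1 then step k (Y k w) (driven k w) else z0.

Lemma measurable_driven n : measurable_fun [set: Omega] (driven n).
Proof.
elim: n => [|n IH]; first exact: measurable_cst.
apply: (measurableT_comp (mstep n) (g := fun w => (Y n w, driven n w))).
exact: measurable_fun_pair.
Qed.

Let pair n w := (Y n w, driven n w).

Let mpair n : measurable_fun [set: Omega] (pair n).
Proof. by apply: measurable_fun_pair => //; exact: measurable_driven. Qed.

Let future (J : {fset nat}) (B : nat -> set S) := \bigcap_(j in [set` J]) (Y j @^-1` B j).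

Let mfuture J B : (forall j, measurable (B j)) -> measurable (future J B).
Proof.
move=> mB; apply: fin_bigcap_measurable => [|j _]; first exact: finite_fset.
by rewrite -[_ @^-1` _]setTI; exact: mY.
Qed.

(* Arbitrary finite sets [J] are needed for the induction: going from [n] to
   [n.+1] applies this to [J] with the time [n] added. *)
Let present_future n := forall (J : {fset nat}) (B : nat -> set S) (A : set Z),
  (forall j, measurable (B j)) -> (forall j, j \in J -> (n <= j)%N) -> measurable A ->
  P (driven n @^-1` A `&` future J B) = (P (driven n @^-1` A) * \prod_(j <- J) mu (B j))%E.

(* On rectangles, this is [present_future] for [n |` J] and for [J]; finite
   measures that agree on rectangles are equal. *)
Let law_pair n J B F (mB : forall j, measurable (B j)) : present_future n ->
  (forall j, j \in J -> (n < j)%N) -> measurable F ->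
  law_on P (mfuture J mB) (mpair n) F =
  (mu \x law_on P (mfuture J mB) (measurable_driven n))%E F.
Proof.
move=> IH Jn mF; symmetry; apply: product_measure_unique mF => C A mC mA.
have mD : measurable (driven n @^-1` A).
  by rewrite -[_ @^-1` _]setTI; exact: measurable_driven.
rewrite /= !law_onE.
have nJ : n \notin J by apply/negP => /Jn; rewrite ltnn.
pose B' j := if j == n then C else B j.
have mB' j : measurable (B' j) by rewrite /B'; case: ifP.
have B'E j : j \in J -> B' j = B j.
  by move=> /Jn; rewrite /B'; case: eqP => // ->; rewrite ltnn.
have -> : pair n @^-1` (C `*` A) `&` future J B = driven n @^-1` A `&` future (n |` J)%fset B'.
  apply/seteqP; split=> [w [[/= wC wA] wJ]|w [/= wA wJ]].
    split=> // j /=; rewrite !inE => /orP[/eqP ->|jJ]; first by rewrite /B' eqxx.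
    by rewrite /= B'E //; exact: wJ.
  have wn : (Y n @^-1` B' n) w by apply: wJ; rewrite /= !inE eqxx.
  split; first by move: wn; rewrite /B' eqxx.
  by move=> j jJ /=; rewrite -B'E //; apply: wJ; rewrite /= !inE [in j \in J]jJ orbT.
rewrite IH //; last by move=> j; rewrite !inE => /orP[/eqP -> //|/Jn /ltnW].
rewrite IH //; last by move=> j /Jn /ltnW.
rewrite big_fsetU1 //= {1}/B' eqxx muleCA; congr (_ * (_ * _))%E.
by apply: eq_big_seq => j jJ; rewrite B'E.
Qed.

Let present_futureP n : present_future n.
Proof.
elim: n => [|n IH] J B A mB Jn mA.
  rewrite /= preimage_cst; case: ifPn => _; last first.
    by rewrite set0I measure0 mul0e.
  by rewrite setTI probability_setT mul1e indep.
pose F := (fun p : S * Z => step n p.1 p.2) @^-1` A.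
have mF : measurable F by rewrite /F -[_ @^-1` _]setTI; exact: mstep.
have E J' : (forall j, j \in J' -> (n < j)%N) ->
    P (driven n.+1 @^-1` A `&` future J' B) =
    (\int[mu]_g (P (driven n @^-1` xsection F g)) * \prod_(j <- J') mu (B j))%E.
  move=> J'n; have /= := law_pair mB IH J'n mF; rewrite law_onE => ->.
  rewrite /product_measure1 /= -ge0_integralZr //; last first.
  - by apply: prode_ge0.
  - have := measurable_fun_xsection (law_on P measurableT (measurable_driven n)) mF.
    by congr measurable_fun; apply/funext => g /=; rewrite law_onE setIT.
  apply: eq_integral => g _; rewrite law_onE IH //; last exact: measurable_xsection.
  by move=> j /J'n /ltnW.
rewrite E //; congr (_ * _)%E; have := E fset0; rewrite big_seq_fset0 mule1.
move=> <- //; congr (P _); rewrite (_ : future _ _ = setT) ?setIT //.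
by apply/seteqP; split=> // w _ j; rewrite /= inE.
Qed.

Lemma law_driven_pair n (F : set (S * Z)) : measurable F ->
  law_on P measurableT (mpair n) F =
  (mu \x law_on P measurableT (measurable_driven n))%E F.
Proof.
move=> mF; have mB (j : nat) : measurable ((fun=> setT) j : set S) by [].
have fT : future fset0 (fun=> setT) = setT.
  by apply/seteqP; split=> // w _ j; rewrite /= inE.
have -> : law_on P measurableT (mpair n) F = law_on P (mfuture fset0 mB) (mpair n) F.
  by rewrite !law_onE fT.
have -> := law_pair mB (@present_futureP n) _ mF; last by move=> j; rewrite inE.
by apply: eq_integral => g _ /=; rewrite !law_onE fT.
Qed.

(** Markov property: integrate first with respect to [Y n], which is independent
   of [driven n]. *)
Lemma driven_markov n (h : Z -> \bar R) :
  measurable_fun [set: Z] h -> (forall z, 0 <= h z)%E ->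
  (\int[P]_w h (driven n.+1 w) = \int[P]_w \int[mu]_g h (step n g (driven n w)))%E.
Proof.
move=> mh h0; pose k p := h (step n p.1 p.2).
have mk : measurable_fun [set: S * Z] k by exact: measurableT_comp.
have k0 p : (0 <= k p)%E by exact: h0.
rewrite -(@integral_law_onT _ _ _ _ _ P _ (measurable_driven n)
  (fun z => \int[mu]_g k (g, z))%E); last 2 first.
  exact: (measurable_fun_fubini_tonelli_G (m1 := mu) k).
  by move=> z; apply: integral_ge0.
have -> : (\int[P]_w h (driven n.+1 w) = \int[law_on P measurableT (mpair n)]_p k p)%E.
  by rewrite integral_law_onT.
rewrite -(fubini_tonelli2 (m1 := mu) (m2 := law_on P measurableT (measurable_driven n)) k) //.
by apply: eq_measure_integral => A mA _ /=; rewrite law_driven_pair.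
Qed.

End Driven.

Section Recurrent.
Context d d1 d2 (Omega : measurableType d) (S : measurableType d1) (Z : measurableType d2).
Variables (R : realType) (P : probability Omega R) (mu : probability S R).
Variables (Y : nat -> Omega -> S) (act : S -> Z -> Z) (z0 : Z).
Hypothesis mY : forall k, measurable_fun [set: Omega] (Y k).
Hypothesis indep : forall (J : {fset nat}) (B : nat -> set S),
  (forall j, measurable (B j)) ->
  P (\bigcap_(j in [set` J]) (Y j @^-1` B j)) = (\prod_(j <- J) mu (B j))%E.
Hypothesis mact : measurable_fun [set: S * Z] (fun p => act p.1 p.2).
Variables (B : set Z) (mB : measurable B).

Let walk := driven Y (fun=> act) z0.

(* The walk, stopped at its first visit to [B] after time [n]: to avoid [B]
   during a whole period becomes an event about the last time of the period. *)
Let stopped_step n k g z := if (n <= k)%N && (z \in B) then z else act g z.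
Let stopped n := driven Y (stopped_step n) z0.

Let mstopped_step n k : measurable_fun [set: S * Z] (fun p => stopped_step n k p.1 p.2).
Proof.
rewrite /stopped_step; case: (n <= k)%N => //=.
apply: measurable_fun_ifT => //.
apply: (measurable_fun_bool true) => //; rewrite setTI.
have -> : (fun p : S * Z => p.2 \in B) @^-1` [set true] = snd @^-1` B.
  by apply/seteqP; split=> -[g z] /=; [move/set_mem|move/mem_set].
by rewrite -[_ @^-1` _]setTI; exact: measurable_snd.
Qed.

Let stoppedE n j w : (forall i, (n <= i < j)%N -> ~ B (walk i w)) -> stopped n j w = walk j w.
Proof.
elim: j => [//|j IH] Bw; rewrite /stopped /walk /= -/(stopped n j w) -/(walk j w).
rewrite IH => [|i /andP[ni ij]]; last by apply: Bw; rewrite ni ltnS ltnW.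
rewrite /stopped_step; case: ifP => // /andP[nj /set_mem Bj].
by case: (Bw j); rewrite ?nj ?leqnn.
Qed.

(* A step of the stopped walk undoes a step of the recursion that defines [hit]:
   on [B] neither moves, off [B] both average. *)
Let Ehit n M j : (\int[P]_w (hit mu act B M (stopped n (n + j) w))%:E =
  \int[P]_w (hit mu act B (M + j) (walk n w))%:E)%E.
Proof.
elim: j M => [|j IH] M.
  rewrite !addn0; apply: eq_integral => w _; rewrite stoppedE // => i.
  by rewrite ltnNge andbN.
have uM k := unit_fun_hit mu mact mB k.
rewrite addnS addnC -addSnnS addnC -IH.
have := driven_markov z0 mY indep (mstopped_step n) (n + j)
  (h := fun z => (hit mu act B M z)%:E).
rewrite -/(stopped n) => ->; last 2 first.
- by apply/measurable_EFinP; case: (uM M).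
- by move=> z; rewrite lee_fin; case: (uM M) => _ /(_ z)/andP[].
apply: eq_integral => w _; set z := stopped n (n + j) w.
rewrite /stopped_step leq_addr andTb.
have [Bz|Bz] := pselect (B z).
  by rewrite mem_set // !hit_in // integral_cst // mul1e; exact: probability_setT.
by rewrite memNset // hitS_out // avgE.
Qed.

Hypothesis hitting1 : forall z, hitting mu act B z = 1.

(** The probability to avoid [B] from time [n] to time [n + j] is
   [1 - E (hit j (walk n))], which tends to [0]. *)
Lemma no_visit_after_null n : P [set w | forall i, (n <= i)%N -> ~ B (walk i w)] = 0%E.
Proof.
set N := [set w | _].
have mwalk k : measurable_fun [set: Omega] (walk k) by exact: measurable_driven.
have mst k : measurable_fun [set: Omega] (stopped n k) by exact: measurable_driven.
have uM k := unit_fun_hit mu mact mB k.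
have mNB : measurable N.
  have -> : N = \bigcap_(i in [set i | (n <= i)%N]) (walk i @^-1` (~` B)) by [].
  apply: bigcap_measurable; first by exists n => /=.
  by move=> i _; rewrite -[_ @^-1` _]setTI; apply: mwalk => //; exact: measurableC.
have PN j : (P N <= 1 - \int[P]_w (hit mu act B j (walk n w))%:E)%E.
  have mst' : measurable (stopped n (n + j) @^-1` B).
    by rewrite -[_ @^-1` _]setTI; exact: mst.
  have := Ehit n 0 j; rewrite add0n => <-.
  have -> : (\int[P]_w (hit mu act B 0 (stopped n (n + j) w))%:E =
             P (stopped n (n + j) @^-1` B))%E.
    by rewrite -[X in P X]setIT -integral_indic //; apply: eq_integral => w _.
  rewrite -probability_setC //; apply: le_measure; rewrite ?inE //; first exact: measurableC.
  move=> w Nw /=; rewrite stoppedE => [|i /andP[ni _]]; last exact: Nw.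
  by apply: Nw; rewrite leq_addr.
have cv : (\int[P]_w (hit mu act B j (walk n w))%:E @[j --> \oo] --> 1)%E.
  have -> : (1 = \int[P]_w (hitting mu act B (walk n w))%:E :> \bar R)%E.
    rewrite (eq_integral (cst 1%E)) => [|w _]; last by rewrite hitting1.
    by rewrite integral_cst // mul1e; apply/esym; exact: probability_setT.
  apply: (@dominated_cvg _ _ _ P setT measurableT _ _ (cst 1%E)) => //.
  - by move=> k; apply/measurable_EFinP; apply: measurableT_comp => //; case: (uM k).
  - move=> w _; apply: cvg_EFin; first exact: nearW.
    exact: (@cvg_hit _ _ _ _ _ mu act mact B mB (walk n w)).
  - by apply: finite_measure_integrable_cst.
  - move=> k w _; rewrite lee_fin; case: (uM k) => _ /(_ (walk n w))/andP[h0 h1].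
    by rewrite ger0_norm.
apply/eqP; rewrite eq_le measure_ge0 andbT.
have /cvge_to_ge : (1 - \int[P]_w (hit mu act B j (walk n w))%:E @[j --> \oo] --> 1 - 1)%E.
  by apply: cvgeB cv => //; exact: cvg_cst.
by rewrite subee //; apply; exact: nearW.
Qed.

Lemma ae_recurrent : {ae P, forall w, lim_sup_set (fun n => [set w | B (walk n w)]) w}.
Proof.
pose N n := [set w | forall i, (n <= i)%N -> ~ B (walk i w)].
have : P.-negligible (\bigcup_n N n).
  apply: negligible_bigcup => n; exists (N n); split=> //; last exact: no_visit_after_null.
  have -> : N n = \bigcap_(i in [set i | (n <= i)%N]) (walk i @^-1` (~` B)) by [].
  apply: bigcap_measurable; first by exists n => /=.
  move=> i _; rewrite -[_ @^-1` _]setTI.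
  by apply: (measurable_driven z0 mY (fun=> mact)) => //; exact: measurableC.
apply: negligibleS => w /= nlim.
have [n nn] : exists n, ~ (exists2 i, (n <= i)%N & B (walk i w)).
  apply/existsNP => h; apply: nlim => n _; have [i ni Bi] := h n.
  by exists i.
by exists n => // i ni Bi; apply: nn; exists i.
Qed.

End Recurrent.

(** * Cut-off functions under quadratic growth *)

Section Profile.
Variable R : realType.
Implicit Types (a t u : R).

Definition ramp a t : R := Num.max 0 (Num.min 1 (2 - t / a)).

Lemma ramp01 a t : 0 <= ramp a t <= 1.
Proof.
by rewrite /ramp /Order.max /Order.min; case: (ltP 1 (2 - t / a)) => ?; case: ltP => ?; lra.
Qed.

Lemma ramp1 a t : 0 < a -> t <= a -> ramp a t = 1.
Proof.
move=> a0 ta; have : t / a <= 1 by rewrite ler_pdivrMr // mul1r.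
by rewrite /ramp /Order.max /Order.min; case: (ltP 1 (2 - t / a)) => ?; case: ltP => ?; lra.
Qed.

Lemma ramp0 a t : 0 < a -> 2 * a <= t -> ramp a t = 0.
Proof.
move=> a0 ta; have : 2 <= t / a by rewrite ler_pdivlMr.
by rewrite /ramp /Order.max /Order.min; case: (ltP 1 (2 - t / a)) => ?; case: ltP => ?; lra.
Qed.

Lemma ramp_lipschitz a t u (k : R) : 0 < a -> `|t - u| <= k ->
  `|ramp a t - ramp a u| <= k / a.
Proof.
move=> a0 tu; have : `|t / a - u / a| <= k / a.
  have a1 : 0 <= a^-1 by rewrite invr_ge0 ltW.
  by rewrite -mulrBl normrM (ger0_norm a1) ler_wpM2r.
by rewrite !ler_norml /ramp /Order.max /Order.min; 
  case: (ltP 1 (2 - t / a)) => ?; case: ltP => ?;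
  case: (ltP 1 (2 - u / a)) => ?; case: ltP => ?; lra.
Qed.

Variables (A k : R).
Hypotheses (A0 : 0 < A) (k0 : 0 <= k) (kA : k <= A).

Definition scale (l : nat) : R := A * 4 ^+ l.

Local Notation a := scale.

Let a0 l : 0 < a l. Proof. by rewrite /scale mulr_gt0 // exprn_gt0. Qed.

Let le_Aa l : A <= a l. Proof. by rewrite /scale ler_peMr ?(ltW A0) // exprn_ege1 //; lra. Qed.

Let aS l L : (l < L)%N -> 4 * a l <= a L.
Proof.
move=> lL; rewrite /scale mulrCA -exprS ler_wpM2l ?(ltW A0) //.
by rewrite ler_weXn2l //; lra.
Qed.

Definition jump t u l : R := ramp (a l) t - ramp (a l) u.

(* The ramps at different scales vary on disjoint ranges, even after the
   ranges are thickened by [k]. *)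
Let jump_disjoint t u l L : `|t - u| <= k -> (l < L)%N -> jump t u L != 0 -> jump t u l = 0.
Proof.
move=> tuk lL; have := aS lL; have := le_Aa L; have := le_Aa l => Al AL all.
have al0 := a0 l; have k_ge0 := k0; have k_leA := kA.
have [tu1 tu2] : - k <= t - u /\ t - u <= k by apply/andP; rewrite -ler_norml.
have [taL|aLt] := leP t (a L); last by move=> _; rewrite /jump !ramp0 ?subrr //; lra.
have [uaL|aLu] := leP u (a L); last by move=> _; rewrite /jump !ramp0 ?subrr //; lra.
by rewrite /jump (ramp1 (a0 L) taL) (ramp1 (a0 L) uaL) subrr eqxx.
Qed.

Let sqr_sum_jump t u L : `|t - u| <= k ->
  (\sum_(l < L) jump t u l) ^+ 2 = \sum_(l < L) jump t u l ^+ 2.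
Proof.
move=> tuk; elim: L => [|L IH]; first by rewrite !big_ord0 expr0n.
rewrite !big_ord_recr /= sqrrD IH; have [->|jL] := eqVneq (jump t u L) 0.
  by rewrite mulr0 mul0rn addr0.
rewrite (_ : \sum_(l < L) jump t u l = 0); last first.
  by apply: big1 => l _; exact: jump_disjoint jL.
by rewrite mul0r mul0rn addr0.
Qed.

(** Each scale contributes a bounded energy under quadratic growth, and there is
   no interaction between scales: averaging over [L] scales divides the energy
   by [L].  This plays the role of a logarithmic cut-off. *)
Definition profile (L : nat) t : R := L%:R^-1 * \sum_(l < L) ramp (a l) t.

Lemma profile01 L t : 0 <= profile L t <= 1.
Proof.
rewrite /profile mulr_ge0 ?invr_ge0 // ?sumr_ge0 //=; last first.
  by move=> l _; case/andP: (ramp01 (a l) t).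
case: L => [|L]; first by rewrite big_ord0 mulr0 ler01.
rewrite mulrC ler_pdivrMr // mul1r.
apply: le_trans (_ : \sum_(l < L.+1) 1 <= _); last by rewrite sumr_const card_ord.
by apply: ler_sum => l _; case/andP: (ramp01 (a l) t).
Qed.

Lemma profile1 L t : (0 < L)%N -> t <= A -> profile L t = 1.
Proof.
move=> L0 tA; rewrite /profile (eq_bigr (fun=> 1)) => [|l _]; last first.
  by rewrite ramp1 // (le_trans tA) // le_Aa.
by rewrite sumr_const card_ord mulVf // pnatr_eq0 -lt0n.
Qed.

Lemma profile0 L t : 2 * a L <= t -> profile L t = 0.
Proof.
move=> aLt; rewrite /profile big1 ?mulr0 // => l _; rewrite ramp0 //.
by have := aS (ltn_ord l); have := a0 l; lra.
Qed.

(** The squares may be summed scale by scale as at most one jump is nonzero; the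
   ramp of scale [a l] has slope at most [1 / a l] and vanishes beyond [2 * a l],
   which the jump of length [k <= a l] relaxes to [3 * a l]. *)
Lemma sqr_profileB t u L : `|t - u| <= k ->
  (profile L t - profile L u) ^+ 2 <=
  \sum_(l < L) (L%:R^-1 * (k / a l)) ^+ 2 * (u <= 3 * a l)%R%:R.
Proof.
move=> tuk; rewrite /profile -mulrBr -sumrB exprMn.
rewrite (sqr_sum_jump L tuk) mulr_sumr; apply: ler_sum => l _.
rewrite [in leRHS]exprMn -[leRHS]mulrA ler_wpM2l ?sqr_ge0 // /jump.
have [ua|au] := leP u (3 * a l).
  rewrite mulr1 -[leLHS]real_normK ?num_real // ler_sqr ?nnegrE //.
    exact: ramp_lipschitz.
  by rewrite divr_ge0 // ltW.
have Al := le_Aa l; have al0 := a0 l; have k_ge0 := k0; have k_leA := kA.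
have [tu1 tu2] : - k <= t - u /\ t - u <= k by apply/andP; rewrite -ler_norml.
by rewrite !ramp0 ?subrr ?expr0n /= ?mulr0 //; lra.
Qed.

End Profile.

Section CutOff.
Context d d' (S : measurableType d) (X : measurableType d') (R : realType).
Variables (mu : probability S R) (act : S -> X -> X) (m : {measure set X -> \bar R}).
Hypothesis act_meas : measurable_fun [set: S * X] (fun p => act p.1 p.2).
Variables (dist : X -> nat) (k n1 : nat) (C : R).
Let ball n := [set y | (dist y <= n)%N].
Hypothesis ball_meas : forall n, measurable (ball n).
Hypothesis ball_growth : forall n, (n1 <= n)%N -> (m (ball n) <= (C * n%:R ^+ 2)%:E)%E.
Hypothesis act_dist : {ae mu, forall g y,
  (dist (act g y) <= dist y + k)%N /\ (dist y <= dist (act g y) + k)%N}.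

Let measurable_fun_dist (phi : nat -> R) : measurable_fun [set: X] (fun y => phi (dist y)).
Proof.
move=> _ U _; rewrite setTI.
have -> : (fun y => phi (dist y)) @^-1` U =
    \bigcup_(n in [set n | U (phi n)]) (ball n `\` \bigcup_(j < n) ball j).
  apply/seteqP; split=> [y /= Uy|y [n /= Un [/= yn yj]]].
    exists (dist y) => //; split=> /=; first by rewrite /ball /=.
    by move=> [j /= jy yj]; move: (leq_trans jy yj); rewrite ltnn.
  have -> // : dist y = n; apply/eqP; rewrite eqn_leq yn leqNgt /=.
  by apply/negP => ny; apply: yj; exists (dist y) => //=; rewrite /ball /=.
apply: bigcup_measurable => n _; apply: measurableD; first exact: ball_meas.
by apply: bigcup_measurable => j _; exact: ball_meas.
Qed.

(** With [a l = A * 4 ^ l], the ball of radius [3 * a l] has measure at most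
   [9 * C * a l ^+ 2], which cancels the squared slope of the ramp of scale
   [a l]: the [L] scales contribute [L * (9 * C * k ^+ 2 / L ^+ 2)]. *)
Lemma exists_cutoff (r : nat) (e : R) : 0 < e -> exists f : X -> R,
  [/\ unit_fun f, m.-integrable [set: X] (EFin \o f),
      forall y, (dist y <= r)%N -> f y = 1 &
      \int[m]_y energy mu act f y <= e].
Proof.
(* The first scale exceeds the jump length [k], the radius [r] and the threshold
   [n1] of the growth bound; [1] makes it positive. *)
move=> e0; pose A := maxn (maxn k r) (maxn n1 1).
have kA : (k <= A)%N by rewrite /A !leq_max leqnn.
have rA : (r <= A)%N by rewrite /A !leq_max leqnn /= ?orbT.
have n1A : (n1 <= A)%N by rewrite /A !leq_max leqnn /= !orbT.
have A0 : (0 < A)%N by rewrite /A !leq_max /= !orbT.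
have AR0 : 0 < A%:R :> R by rewrite ltr0n.
have kAR : k%:R <= A%:R :> R by rewrite ler_nat.
have aE l : scale A%:R l = (A * 4 ^ l)%:R :> R by rewrite /scale natrM natrX.
have n1a l : (n1 <= A * 4 ^ l)%N by rewrite (leq_trans n1A) // leq_pmulr // expn_gt0.
have a0 l : 0 < (A * 4 ^ l)%:R :> R by rewrite ltr0n muln_gt0 A0 expn_gt0.
have [L0 L0P] : exists L0 : nat, 9 * C * k%:R ^+ 2 / e < L0.+1%:R.
  by eexists; exact: truncnS_gt.
pose L := L0.+1.
pose f y : R := profile A%:R L (dist y)%:R.
have uf : unit_fun f.
  by split=> [|y]; [exact: (measurable_fun_dist (fun n => profile A%:R L n%:R))|exact: profile01].
have ball_fin n : (n1 <= n)%N -> (m (ball n) < +oo)%E.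
  by move=> /ball_growth /le_lt_trans; apply; rewrite ltry.
have ball_int n : (n1 <= n)%N -> m.-integrable [set: X] (EFin \o (\1_(ball n) : X -> R)).
  move=> nn; apply/integrableP; split; first exact/measurable_EFinP/measurable_indic.
  under eq_integral do rewrite gee0_abs ?lee_fin //.
  by rewrite integral_indic // setIT ball_fin.
have intf : m.-integrable [set: X] (EFin \o f).
  have n1L : (n1 <= 2 * (A * 4 ^ L))%N by rewrite (leq_trans (n1a L)) // leq_pmull.
  apply: dominated_int (ball_int _ n1L); first by case: uf.
  move=> y; have [_ /(_ y)/andP[-> f1 /=]] := uf; rewrite indicE.
  have [yL|yL] := leqP (dist y) (2 * (A * 4 ^ L)); first by rewrite mem_set.
  by rewrite /f profile0 // aE -natrM ler_nat ltnW.
exists f; split=> // [y yr|].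
  by rewrite /f profile1 // ler_nat (leq_trans yr).
pose c l : R := (L%:R^-1 * (k%:R / scale A%:R l)) ^+ 2.
pose s := [seq (c l, \1_(ball (3 * (A * 4 ^ l))) : X -> R) | l <- iota 0 L].
have n13 l : (n1 <= 3 * (A * 4 ^ l))%N by rewrite (leq_trans (n1a l)) // leq_pmull.
have [|ints sE] := @Rintegral_lincomb _ _ _ m s.
  by rewrite all_map; apply/allP => l _ /=; exact: ball_int.
have in_ball n y : (y \in ball n) = (dist y <= n)%N.
  by apply/idP/idP => [/set_mem //|yn]; exact: mem_set.
have bE y : \sum_(p <- s) p.1 * p.2 y =
    \sum_(l < L) c l * ((dist y)%:R <= 3 * scale A%:R l :> R)%R%:R.
  rewrite big_map -[iota 0 L]/(index_iota 0 L) big_mkord; apply: eq_bigr => l _ /=.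
  by rewrite aE -natrM ler_nat indicE in_ball.
have energy_le y : energy mu act f y <= \sum_(p <- s) p.1 * p.2 y.
  rewrite -lee_fin /energy Rintegral_unit_funE; last exact: unit_fun_energy_section.
  have -> : ((\sum_(p <- s) p.1 * p.2 y)%:E =
      \int[mu]_g (cst (\sum_(p <- s) p.1 * p.2 y)%:E g))%E.
    by rewrite integral_cst // -[LHS]mule1; congr (_ * _)%E; apply/esym; exact: probability_setT.
  apply: ae_ge0_le_integral => //.
  - by move=> g _; rewrite lee_fin sqr_ge0.
  - by apply/measurable_EFinP; case: (unit_fun_energy_section act_meas y uf).
  - by move=> g _; rewrite lee_fin bE sumr_ge0 // => l _; rewrite mulr_ge0 ?sqr_ge0.
  case: act_dist => N [mN N0 dN]; exists N; split=> // g /= ng; apply: dN => /= dg.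
  apply: ng => _; rewrite lee_fin bE; apply: sqr_profileB => //.
  have [d1 d2] : (dist (act g y))%:R <= (dist y)%:R + k%:R :> R /\
      (dist y)%:R <= (dist (act g y))%:R + k%:R :> R by rewrite -!natrD !ler_nat.
  by rewrite ler_norml; apply/andP; split; lra.
apply: le_trans (_ : \int[m]_y (\sum_(p <- s) p.1 * p.2 y) <= _).
  have [me e01] := unit_fun_energy mu act_meas uf.
  apply: le_Rintegral => [//|||y _]; [|exact: ints|exact: energy_le].
  by apply: dominated_int ints => // y; rewrite energy_le andbT; case/andP: (e01 y).
rewrite sE big_map -[iota 0 L]/(index_iota 0 L) big_mkord.
apply: le_trans (_ : \sum_(l < L) (9 * C * k%:R ^+ 2) / L%:R ^+ 2 <= _).
  apply: ler_sum => l _ /=.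
  have -> : (9 * C * k%:R ^+ 2) / L%:R ^+ 2 = c l * (C * (3 * (A * 4 ^ l))%:R ^+ 2) :> R.
    rewrite /c aE [(3 * _)%:R]natrM.
    by field; rewrite !pnatr_eq0 -!lt0n expn_gt0 A0.
  rewrite ler_wpM2l ?sqr_ge0 // -lee_fin /Rintegral integral_indic // setIT fineK.
    exact: ball_growth.
  by rewrite ge0_fin_numE // ball_fin.
rewrite sumr_const card_ord -[leLHS]mulr_natr.
rewrite (_ : _ * _ = 9 * C * k%:R ^+ 2 / L%:R); last by field; rewrite pnatr_eq0.
by rewrite ler_pdivrMr ?ltr0Sn // [leRHS]mulrC -ler_pdivrMr // ltW.
Qed.

End CutOff.

(** * Walks driven by a group action *)

(** Both conditions say that the product measure of [E] vanishes. *)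
Lemma null_sections d1 d2 (T1 : measurableType d1) (T2 : measurableType d2) (R : realType)
    (m1 : {sigma_finite_measure set T1 -> \bar R})
    (m2 : {sigma_finite_measure set T2 -> \bar R}) (E : set (T1 * T2)) :
  measurable E -> {ae m1, forall x, m2 (xsection E x) = 0%E} ->
  {ae m2, forall y, m1 (ysection E y) = 0%E}.
Proof.
move=> mE ae1.
have m1E : measurable_fun [set: T1] (m2 \o xsection E) by exact: measurable_fun_xsection.
have m2E : measurable_fun [set: T2] (m1 \o ysection E) by exact: measurable_fun_ysection.
have I1 : (\int[m1]_x (m2 \o xsection E) x = 0)%E.
  transitivity (\int[m1]_x `|(m2 \o xsection E) x|)%E.
    by apply: eq_integral => x _; rewrite gee0_abs ?measure_ge0.
  apply/(ae_eq_integral_abs m1 measurableT m1E).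
  by case: ae1 => N [mN N0 EN]; exists N; split=> // x /= nx; apply: EN => /= ex; apply: nx.
have I2 : (\int[m2]_y (m1 \o ysection E) y = 0)%E.
  have := indic_fubini_tonelli m1 m2 mE.
  rewrite indic_fubini_tonelli_FE // indic_fubini_tonelli_GE // => <-.
  exact: I1.
have : (\int[m2]_y `|(m1 \o ysection E) y| = 0)%E.
  by rewrite -[RHS]I2; apply: eq_integral => y _; rewrite gee0_abs ?measure_ge0.
move/(ae_eq_integral_abs m2 measurableT m2E) => -[N [mN N0 EN]].
by exists N; split=> // y /= ny; apply: EN => /= ey; apply: ny; exact: ey.
Qed.

Section Walk.
Variables (R : realType) (G : topologicalGroupType) (X : ptopologicalType).
Variable act : G -> X -> X.
Hypotheses (act1 : forall x, act 1%g x = x)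
  (actM : forall g h x, act (g * h)%g x = act g (act h x))
  (act_trans : forall x y, exists g, act g x = y)
  (act_cont : continuous (fun p : G * X => act p.1 p.2))
  (G2 : @second_countable G) (X2 : @second_countable X).

Let act_meas : measurable_fun [set: borelType G * borelType X]
  (fun p : borelType G * borelType X => act p.1 p.2 : borelType X).
Proof. exact: (continuous_measurable_prod G2 X2 act_cont). Qed.

Let mul_meas : measurable_fun [set: borelType G * borelType G]
  (fun p : borelType G * borelType G => (p.1 * p.2)%g : borelType G).
Proof. exact: (continuous_measurable_prod G2 G2 (@mulg_continuous G)). Qed.

Let inv_meas :
  measurable_fun [set: borelType G] (fun g : borelType G => (g : G)^-1%g : borelType G).
Proof. exact: (continuous_measurable_borel (@invg_continuous G)). Qed.

Let actK g x : act g^-1%g (act g x) = x. Proof. by rewrite -actM mulVg act1. Qed.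
Let actVK g x : act g (act g^-1%g x) = x. Proof. by rewrite -actM mulgV act1. Qed.

Let act_image g (A : set X) : act g @` A = act g^-1%g @^-1` A.
Proof.
by apply/seteqP; split=> [_ [x Ax <-]|x Ax] /=; [rewrite actK|exists (act g^-1%g x)].
Qed.

Let mact g : measurable_fun [set: borelType X] (act g : borelType X -> borelType X).
Proof.
exact: (measurable_fun_pair2
  (f := fun p : borelType G * borelType X => act p.1 p.2 : borelType X)).
Qed.

Variable mX : {sigma_finite_measure set (borelType X) -> \bar R}.
Hypothesis mX_inv : forall g (A : set (borelType X)), measurable A -> mX (act g @` A) = mX A.

Lemma invariant_integral g (f : borelType X -> \bar R) :
  measurable_fun [set: borelType X] f -> (forall x, 0 <= f x)%E ->
  (\int[mX]_x f (act g x) = \int[mX]_x f x)%E.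
Proof.
move=> mf f0.
transitivity (\int[pushforward mX (act g : borelType X -> borelType X)]_x f x)%E.
  by rewrite (ge0_integral_pushforward (mact g)).
apply: eq_measure_integral => A mA _ /=.
by rewrite /pushforward -[RHS](mX_inv g^-1%g mA) act_image invgK.
Qed.

Variable mu : probability (borelType G) R.
Hypothesis mu_sym : symmetric_law mu.

Lemma symmetric_integral (f : borelType G -> \bar R) :
  measurable_fun [set: borelType G] f -> (forall x, 0 <= f x)%E ->
  (\int[mu]_g f (g : G)^-1%g = \int[mu]_g f g)%E.
Proof.
move=> mf f0; pose inv (g : borelType G) : borelType G := (g : G)^-1%g.
transitivity (\int[pushforward mu inv]_g f g)%E.
  by rewrite (ge0_integral_pushforward inv_meas).
apply: eq_measure_integral => A mA _ /=.
rewrite /pushforward [RHS](mu_sym mA); congr (mu _).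
apply/seteqP; split=> [g Ag|_ [g Ag <-]]; last by rewrite /preimage /inv /= invgK.
by exists (inv g); rewrite /inv ?invgK.
Qed.

Local Notation avg := (avg mu (act : borelType G -> borelType X -> borelType X)).

(** Substitute [g^-1 x] for [x] by invariance, then [g^-1] for [g] by
   symmetry. *)
Lemma walk_reversible (f h : borelType X -> R) : unit_fun f -> unit_fun h ->
  (\int[mX]_x (f x * avg h x)%:E = \int[mX]_x (avg f x * h x)%:E)%E.
Proof.
move=> uf uh; have [[mf f01] [mh h01]] := (uf, uh).
have f0 x : (0 <= (f x)%:E)%E by rewrite lee_fin; case/andP: (f01 x).
have h0 x : (0 <= (h x)%:E)%E by rewrite lee_fin; case/andP: (h01 x).
pose k (p : borelType G * borelType X) : \bar R := ((f p.2)%:E * (h (act p.1 p.2))%:E)%E.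
pose k' (p : borelType G * borelType X) : \bar R := ((h p.2)%:E * (f (act p.1 p.2))%:E)%E.
have mE (u : borelType X -> R) : measurable_fun [set: borelType X] u ->
    measurable_fun [set: borelType G * borelType X] (fun p => (u p.2)%:E) /\
    measurable_fun [set: borelType G * borelType X] (fun p => (u (act p.1 p.2))%:E).
  move=> mu'; split; apply/measurable_EFinP; last exact: (measurableT_comp mu' act_meas).
  exact: (measurableT_comp mu' measurable_snd).
have mk : measurable_fun [set: borelType G * borelType X] k.
  by apply: emeasurable_funM; [exact: (mE f mf).1|exact: (mE h mh).2].
have mk' : measurable_fun [set: borelType G * borelType X] k'.
  by apply: emeasurable_funM; [exact: (mE h mh).1|exact: (mE f mf).2].
have k0 p : (0 <= k p)%E by apply: mule_ge0.
have k'0 p : (0 <= k' p)%E by apply: mule_ge0.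
have avgk (u v : borelType X -> R) : unit_fun u -> unit_fun v ->
    forall x, (u x * avg v x)%:E = (\int[mu]_g ((u x)%:E * (v (act g x))%:E))%E.
  move=> [_ u01] uv x; rewrite EFinM avgE // ge0_integralZl_EFin //.
  - by move=> g _; rewrite lee_fin; case: uv => _ /(_ (act g x))/andP[].
  - by apply/measurable_EFinP; case: (unit_fun_act act_meas x uv).
  - by case/andP: (u01 x).
transitivity (\int[mX]_x \int[mu]_g k (g, x))%E.
  by apply: eq_integral => x _; rewrite avgk.
transitivity (\int[mX]_x \int[mu]_g k' (g, x))%E; last first.
  by apply: eq_integral => x _; rewrite mulrC avgk.
rewrite -!fubini_tonelli //.
have mF' : measurable_fun [set: borelType G] (fun g => \int[mX]_x k' (g, x))%E.
  exact: (measurable_fun_fubini_tonelli_F k').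
rewrite -(symmetric_integral mF') => [|g]; last exact: integral_ge0.
apply: eq_integral => g _.
rewrite -(invariant_integral g (f := fun x => k' (g^-1%g, x))) => [||x]; last exact: k'0.
  by apply: eq_integral => x _; rewrite /k /k' /= actK muleC.
exact: (measurable_fun_pair2 (f := k')).
Qed.

(** * Word distance *)

(** The complement of the support is a union of null open sets, hence a
   countable union of null basic open sets. *)
Lemma ae_msupp : {ae mu, forall g, msupp mu g}.
Proof.
have [b [bo bnbhs]] := countable_base G2.
pose c n : set (borelType G) := if mu (b n) == 0%E then b n else set0.
have mc n : measurable (c n) by rewrite /c; case: ifP => // _; exact: open_measurable_borel.
have : mu.-negligible (\bigcup_n c n).
  apply: negligible_bigcup => n; exists (c n); split => //.
  by rewrite /c; case: eqP => // _; rewrite measure0.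
apply: negligibleS => g /= /existsNP[U /not_implyP[oU /not_implyP[Ug U0]]].
have [n bg bU] := bnbhs g U (open_nbhs_nbhs (conj oU Ug)).
exists n => //; rewrite /c ifT //; apply/eqP/le_anti; rewrite measure_ge0 andbT.
have -> : (0 = mu U)%E by apply/le_anti; rewrite measure_ge0 /= leNgt; apply/negP.
by apply: le_measure; rewrite ?inE //; exact: open_measurable_borel.
Qed.

Section WordDistance.
Variables (V : set G) (x0 : X).
Hypotheses (V1 : nbhs (1%g : G) V) (VT : \bigcup_n setpowg V n = setT).

Lemma setpowgD m n g h :
  setpowg V m g -> setpowg V n h -> setpowg V (m + n) (g * h)%g.
Proof.
elim: m g => [|m IH] g /=; first by move=> -> ?; rewrite mul1g.
by move=> [v Vv [a Va <-]] Vh; exists v => //; exists (a * h)%g; [exact: IH|rewrite mulgA].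
Qed.

Lemma subset_setpowg m n : (m <= n)%N -> setpowg V m `<=` setpowg V n.
Proof.
move=> /subnK <- g Vg; elim: (n - m)%N => [//|k IH] /=.
by exists 1%g; [exact: nbhs_singleton|exists g; rewrite ?mul1g].
Qed.

Lemma setpowg_interior n : setpowg V n `<=` (setpowg V n.+1)°.
Proof.
move=> g Vg; rewrite /interior nbhsE; exists [set h * g | h in V°]%g.
  split; first by apply: open_mulgr; exact: open_interior.
  by exists 1%g; rewrite ?mul1g.
by move=> _ [h /interior_subset Vh <-]; exists h => //; exists g.
Qed.

Lemma compact_setpowg K : compact K -> exists k, K `<=` setpowg V k.
Proof.
rewrite compact_cover => /(_ nat setT (fun n => (setpowg V n.+1)°)).
case=> [n _|g Kg|D _ KD]; first exact: open_interior.
  have [n _ Vg] : (\bigcup_n setpowg V n) g by rewrite VT.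
  by exists n => //; exact: setpowg_interior.
exists (\max_(n <- D) n.+1)%N => g /KD[n /= nD /interior_subset Vg].
have nmax : (n.+1 <= \max_(n <- D) n.+1)%N by by rewrite (big_rem n nD) /= leq_maxl.
exact: (subset_setpowg nmax Vg).
Qed.

Definition orbit_ball n : set X := [set act g x0 | g in setpowg V n].

Let orbit_ballT y : exists n, `[< orbit_ball n y >].
Proof.
have [g <-] := act_trans x0 y; have [n _ Vg] : (\bigcup_n setpowg V n) g by rewrite VT.
by exists n; apply/asboolP; exists g.
Qed.

(** As [V] need not be symmetric, this is not a distance. *)
Definition word_dist y : nat := ex_minn (orbit_ballT y).

Lemma le_word_dist y n : (word_dist y <= n)%N <-> orbit_ball n y.
Proof.
rewrite /word_dist; case: ex_minnP => j /asboolP [g Vg gy] jmin; split=> [jn|yn].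
  by exists g => //; exact: subset_setpowg Vg.
by apply: jmin; apply/asboolP.
Qed.

Lemma word_dist_act k g y :
  setpowg V k g -> (word_dist (act g y) <= word_dist y + k)%N.
Proof.
move=> Vg; apply/le_word_dist; have [h Vh hy] := (le_word_dist y (word_dist y)).1 (leqnn _).
by exists (g * h)%g; [rewrite addnC; exact: setpowgD|rewrite actM hy].
Qed.

End WordDistance.

Lemma msupp_inv g : msupp mu g -> msupp mu g^-1%g.
Proof.
move=> sg U oU Ug; rewrite [X in (_ < X)%E](mu_sym (open_measurable_borel oU)).
have -> : [set (x : G)^-1%g | x in U] = (fun x : G => x^-1%g) @^-1` U.
  apply/seteqP; split=> [_ [x Ux <-]|x Ux] /=; first by rewrite invgK.
  by exists x^-1%g => //; rewrite invgK.
apply: sg => //.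
by move/continuousP: (@invg_continuous G); apply.
Qed.

Hypothesis mu_compact : compact (msupp mu).

Local Notation bact := (act : borelType G -> borelType X -> borelType X).
Local Notation hitting := (hitting mu bact).

(** The support of [mu] is symmetric and contained in some [V^k], whence the
   bound on the increments of [word_dist] in both directions. *)
Lemma ae_avg_hitting_walk (V : set G) (x0 : X) (C : R) (n1 r : nat) (B : set (borelType X)) :
  nbhs (1%g : G) V -> \bigcup_n setpowg V n = setT ->
  (forall n, measurable (orbit_ball V x0 n : set (borelType X))) ->
  (forall n, (n1 <= n)%N -> (mX (orbit_ball V x0 n) <= (C * n%:R ^+ 2)%:E)%E) ->
  measurable B -> B `<=` orbit_ball V x0 r ->
  {ae mX, forall x, avg (hitting B) x = hitting B x}.
Proof.
move=> V1 VT mV growth mB Br.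
have [k Vk] := compact_setpowg V1 VT mu_compact.
have distE n : [set y | (word_dist x0 VT y <= n)%N] = orbit_ball V x0 n.
  by apply/seteqP; split=> y /=; move/(le_word_dist x0 V1 VT).
apply: (ae_avg_hitting act_meas mB walk_reversible).
  apply: le_lt_trans (_ : mX (orbit_ball V x0 (maxn n1 r)) < +oo)%E.
    apply: le_measure; rewrite ?inE // => y /Br [g Vg <-].
    by exists g => //; apply: subset_setpowg Vg => //; exact: leq_maxr.
  by apply: le_lt_trans (growth _ (leq_maxl _ _)) _; rewrite ltry.
move=> e e0.
have [n|n nn||f [uf intf fr Ef]] :=
    @exists_cutoff _ _ _ _ _ mu bact mX act_meas (word_dist x0 VT) k n1 C _ _ _ r e e0.
- by rewrite distE.
- by rewrite distE; exact: growth.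
- case: ae_msupp => N [mN N0 sN]; exists N; split => // g /= ng; apply: sN => /= sg.
  apply: ng => y; split; first exact/word_dist_act/Vk.
  by rewrite -{1}[y](actK g); apply/word_dist_act/Vk/msupp_inv.
exists f; split=> // y By; apply: fr.
by apply/(le_word_dist x0 V1 VT); exact: Br.
Qed.

(** * Propagation of harmonicity *)

Hypothesis mu_adapted : adapted mu.

Section Propagation.
Variables (h : borelType X -> R) (B : set X).
Hypotheses (uh : unit_fun h) (ah : {ae mX, forall x, avg h x = h x})
  (oB : open B) (B0 : B !=set0) (hB : forall x, B x -> h x = 1).

Let N : set (borelType X) := [set x | h x < 1].

Let mN : measurable N.
Proof.
by rewrite -[X in measurable X]setTI; apply: measurable_fun_ltr => //; case: uh.
Qed.

(* For almost every [x] in [W], [1 = h x] is the mean of the values [h (g x)],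
   which are at most [1]: so [h (g x) = 1] for almost every [g].  Exchange the
   order of [x] and [g]. *)
Let translate_null (W : set X) : open W -> mX (W `&` N) = 0%E ->
  {ae mu, forall g, mX (act g @` W `&` N) = 0%E}.
Proof.
move=> oW W0; have mW : measurable (W : set (borelType X)) by exact: open_measurable_borel.
pose E : set (borelType X * borelType G) :=
  [set p | W p.1] `&` (fun p => act p.2 p.1) @^-1` N.
have msw : measurable_fun [set: borelType X * borelType G]
    (fun p => act p.2 p.1 : borelType X).
  apply: (measurableT_comp act_meas (g := fun p : borelType X * borelType G => (p.2, p.1))).
  exact: measurable_swap.
have mE : measurable E.
  apply: measurableI; first by rewrite -[X in measurable X]setTI; exact: measurable_fst.
  by rewrite -[X in measurable X]setTI; exact: msw.
have : {ae mX, forall x, mu (xsection E x) = 0%E}.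
  case: ah => M [mM M0 hM]; exists (M `|` (W `&` N)); split.
  - by apply: measurableU => //; exact: measurableI.
  - by rewrite measureU0 //; exact: measurableI.
  move=> x /= Ex; apply: contrapT => /not_orP[Mx WNx]; apply: Ex.
  have [Wx|Wx] := pselect (W x); last first.
    have -> : xsection E x = set0 by apply/seteqP; split=> // g /xsectionP[].
    by rewrite measure0.
  have hx1 : h x = 1.
    apply/eqP; rewrite eq_le; have [_ /(_ x)/andP[_ ->]] /= := uh.
    by rewrite leNgt; apply/negP => hx; apply: WNx.
  have ax : avg h x = 1.
    by apply: contrapT => axn; apply: Mx; apply: hM; rewrite /= hx1.
  have -> : xsection E x = [set g : borelType G | h (act g x) < 1].
    by apply/seteqP; split=> [g /xsectionP[]|g hg]; [|apply/xsectionP].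
  exact: (unit_fun_mean1 (unit_fun_act act_meas x uh) ax).
move/(null_sections mE) => -[M [mM M0 EM]]; exists M; split=> // g /= ng; apply: EM => /= Eg.
apply: ng; rewrite -[RHS]Eg -[RHS](mX_inv g); last exact: measurable_ysection.
congr (mX _); apply/seteqP; split=> [_ [[x Wx <-] Ngx]|_ [x /ysectionP[/= Wx Nx] <-]].
  by exists x => //; apply/ysectionP.
by split => //; exists x.
Qed.

Let O := [set y | exists W, [/\ open W, W y & mX (W `&` N) = 0%E]].

Let act_cont1 g : continuous (act g).
Proof.
move=> x; apply: (@continuous_comp _ _ _ (fun x => (g, x)) (fun p : G * X => act p.1 p.2)).
  by apply: cvg_pair => //; exact: cvg_cst.
exact: act_cont.
Qed.

Let act_cont2 y : continuous (act ^~ y).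
Proof.
move=> g; apply: (@continuous_comp _ _ _ (fun g => (g, y)) (fun p : G * X => act p.1 p.2)).
  by apply: cvg_pair => //; exact: cvg_cst.
exact: act_cont.
Qed.

Let act_inv_cont y : continuous (fun g : G => act g^-1%g y).
Proof.
move=> g; apply: (@continuous_comp _ _ _ (fun g : G => g^-1%g) (act ^~ y)).
  exact: invg_continuous.
exact: act_cont2.
Qed.

(* Almost all [g'] are good for [translate_null], in particular some [g'] so
   close to [g] that [g' W] is still a neighborhood of [g y]. *)
Let O_msupp g y : msupp mu g -> O y -> O (act g y).
Proof.
move=> sg [W [oW Wy W0]].
pose U := [set g' : G | W (act g'^-1%g (act g y))].
have oU : open U.
  by apply: (open_comp _ oW) => g' _; exact: act_inv_cont.
have Ug : U g by rewrite /U /= actK.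
have [M [mM M0 WM]] := translate_null oW W0.
have [g' Ug' Mg'] : exists2 g', U g' & ~ M g'.
  apply: contrapT => nex; have := sg U oU Ug; apply/negP; rewrite -leNgt -M0.
  apply: le_measure; rewrite ?inE //; first exact: open_measurable_borel.
  by move=> g' Ug'; apply: contrapT => Mg'; apply: nex; exists g'.
exists (act g' @` W); split.
- by rewrite act_image; apply: (open_comp _ oW) => x _; exact: act_cont1.
- by exists (act g'^-1%g (act g y)); rewrite ?actVK.
by apply: contrapT => gW; apply: Mg'; exact: WM.
Qed.

Let open_O : open O.
Proof.
rewrite openE => y [W [oW Wy W0]]; rewrite /interior nbhsE; exists W => // z Wz.
by exists W.
Qed.

(* The stabilizer [H] of [O] is closed because [O] is open: for [g'] in [H] close
   to [g], the point [g'^-1 (g y)] is close to [y], hence in [O] with [y]. *)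
Let OT : O = setT.
Proof.
pose H := [set g | forall y, O y <-> O (act g y)].
have H_V g : H g -> H g^-1%g by move=> Hg y; rewrite (Hg (act g^-1%g y)) actVK.
have H_M g g' : H g -> H g' -> H (g * g')%g.
  by move=> Hg Hg' y; rewrite actM -Hg.
have Hsupp : msupp mu `<=` H.
  move=> g sg y; split; first exact: O_msupp.
  by move=> /(O_msupp (msupp_inv sg)); rewrite actK.
have cH : closed H.
  move=> g clg; have near (U : set G) : open U -> U g -> exists2 g', H g' & U g'.
    by move=> oU Ug; have [g' [Hg' Ug']] := clg U (open_nbhs_nbhs (conj oU Ug)); exists g'.
  move=> y; split=> [Oy|Ogy].
    have [||g' Hg' Og'] := near [set g' : G | O (act g'^-1%g (act g y))].
    - by apply: (open_comp _ open_O) => g' _; exact: act_inv_cont.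
    - by rewrite /= actK.
    by have := (Hg' _).1 Og'; rewrite actVK.
  have [||g' Hg' Og'] := near [set g' : G | O (act g' y)] => //.
  - by apply: (open_comp _ open_O) => g' _; exact: act_cont2.
  exact: (Hg' y).2.
have HT : H = setT.
  apply/seteqP; split=> // g _; have := mu_adapted; rewrite /adapted => /seteqP[_ /(_ g I)].
  apply; split=> //; split=> //; split; first by rewrite inE => y; rewrite act1.
  by move=> x y /set_mem Hx /set_mem Hy; rewrite inE; apply/H_M/H_V.
apply/seteqP; split=> // y _; have [x Bx] := B0; have [g <-] := act_trans x y.
have Hg : H g by rewrite HT.
apply: (Hg x).1; exists B; split=> //.
have -> : B `&` N = set0; last exact: measure0.
by apply/seteqP; split=> // z [Bz]; rewrite /N /= hB // ltxx.
Qed.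

(** Near each point [h = 1] almost everywhere, and countably many basic open
   sets suffice to cover the space. *)
Lemma propagation : mX [set x | h x < 1] = 0%E.
Proof.
have [b [bo bnbhs]] := countable_base X2.
pose c n : set (borelType X) := if mX (b n `&` N) == 0%E then b n `&` N else set0.
have mc n : measurable (c n).
  rewrite /c; case: ifP => // _; apply: measurableI => //; exact: open_measurable_borel.
have /negligibleP : mX.-negligible (\bigcup_n c n).
  apply: negligible_bigcup => n; exists (c n); split=> //.
  by rewrite /c; case: eqP => // _; rewrite measure0.
move=> /(_ (bigcupT_measurable _ mc)) c0.
apply: (subset_measure0 _ (bigcupT_measurable _ mc) _ c0) => // x Nx.
have [W [oW Wx W0]] : O x by rewrite OT.
have [n bx bW] := bnbhs x W (open_nbhs_nbhs (conj oW Wx)).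
exists n => //; rewrite /c ifT //; apply/eqP.
apply: (subset_measure0 _ _ _ W0) => [||z [bz Nz]]; last by split => //; exact: bW.
  by apply: measurableI => //; exact: open_measurable_borel.
by apply: measurableI => //; exact: open_measurable_borel.
Qed.

End Propagation.

(** * Null sets of Haar measures *)

Section HaarNull.
Variable mG : {sigma_finite_measure set (borelType G) -> \bar R}.
Hypotheses (mG_inv : forall g (A : set (borelType G)), measurable A ->
    mG ((fun h : G => g * h)%g @` A) = mG A)
  (mG0 : mG setT <> 0%E) (mX0 : mX setT <> 0%E).

Let mul_image (g : G) (A : set G) : (fun h => g * h)%g @` A = (fun h => g^-1 * h)%g @^-1` A.
Proof.
apply/seteqP; split=> [_ [h Ah <-]|h Ah] /=; first by rewrite mulKg.
by exists (g^-1 * h)%g; rewrite ?mulVKg.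
Qed.

Let mpreim (f : borelType G -> borelType G) (A : set (borelType G)) :
  measurable_fun [set: borelType G] f -> measurable A -> measurable (f @^-1` A).
Proof. by move=> mf mA; rewrite -[X in measurable X]setTI; exact: mf. Qed.

Let ae_exists d (T : measurableType d) (m : {measure set T -> \bar R}) (P : T -> Prop) :
  m setT <> 0%E -> {ae m, forall x, P x} -> exists x, P x.
Proof.
move=> m0 [M [mM M0 PM]]; apply: contrapT => nP; apply: m0.
apply: (subset_measure0 _ mM _ M0) => // x _; apply: PM => /= Px.
by apply: nP; exists x.
Qed.

(** Consider the pairs [(g, h)] with [g^-1 h] in [A].  For fixed [g], these [h] form
   [g A], which is null; so for some [h], the corresponding [g] form a null set,
   which is a left translate of the inverse of [A]. *)
Lemma haar_null_inv (A : set (borelType G)) : measurable A -> mG A = 0%E ->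
  mG [set g | A (g : G)^-1%g] = 0%E.
Proof.
move=> mA A0; pose f (p : borelType G * borelType G) : borelType G := ((p.1 : G)^-1 * p.2)%g.
have mf : measurable_fun [set: borelType G * borelType G] f.
  apply: (measurableT_comp mul_meas
    (g := fun p : borelType G * borelType G => ((p.1 : G)^-1%g : borelType G, p.2))).
  apply: measurable_fun_pair; last exact: measurable_snd.
  exact: (measurableT_comp inv_meas measurable_fst).
have mE : measurable (f @^-1` A) by rewrite -[X in measurable X]setTI; exact: mf.
have : {ae mG, forall g, mG (xsection (f @^-1` A) g) = 0%E}.
  apply: aeW => g; rewrite -[RHS]A0 -(mG_inv g mA) mul_image; congr (mG _).
  by apply/seteqP; split=> h; [move/xsectionP|move=> ?; apply/xsectionP].
move=> /(null_sections mE) /(ae_exists mG0)[h] <-.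
rewrite -(mG_inv h); last exact: (mpreim inv_meas mA).
congr (mG _); rewrite mul_image; apply/seteqP; split=> g /=.
  by rewrite invgM invgK => Ag; apply/ysectionP.
by move/ysectionP; rewrite invgM invgK.
Qed.

(** Inversion turns right translations into left translations. *)
Lemma haar_null_mulr (A : set (borelType G)) (k : G) : measurable A -> mG A = 0%E ->
  mG [set g | A (g * k)%g] = 0%E.
Proof.
move=> mA A0; pose A' : set (borelType G) := [set g | A (g : G)^-1%g].
have mA' : measurable A' by exact: (mpreim inv_meas mA).
have mkA' : measurable ((fun h : G => k * h)%g @` A' : set (borelType G)).
  rewrite mul_image; apply: mpreim mA'.
  exact: (continuous_measurable_borel (@mulgl_continuous G _)).
have /(haar_null_inv mkA') : mG ((fun h : G => k * h)%g @` A') = 0%E.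
  by rewrite mG_inv //; exact: haar_null_inv.
congr (mG _ = _); rewrite mul_image; apply/seteqP; split=> g /=;
  by rewrite /A' /= invgM !invgK.
Qed.

(** By Fubini's theorem for the pairs [(g, x)] with [g x] in [N], this holds for
   some [x]; the other points are translates, for which the set is translated on
   the right. *)
Lemma haar_null_orbit (N : set (borelType X)) (x : X) : measurable N -> mX N = 0%E ->
  mG [set g | N (act g x)] = 0%E.
Proof.
move=> mN N0; pose f (p : borelType G * borelType X) : borelType X := act p.1 p.2.
have mE : measurable (f @^-1` N).
  by rewrite -[X in measurable X]setTI; exact: act_meas.
have : {ae mG, forall g, mX (xsection (f @^-1` N) g) = 0%E}.
  apply: aeW => g; rewrite -[RHS]N0 -(mX_inv g^-1%g mN) act_image invgK; congr (mX _).
  by apply/seteqP; split=> h; [move/xsectionP|move=> ?; apply/xsectionP].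
move=> /(null_sections mE) /(ae_exists mX0)[y Ny].
have [k <-] := act_trans y x.
have := haar_null_mulr k (measurable_ysection y mE) Ny.
congr (mG _ = _); apply/seteqP; split=> g.
  by move=> yg; have := (ysectionP (g * k)%g y (f @^-1` N)).1 yg; rewrite /f /= actM.
by move=> Ng; apply: (ysectionP (g * k)%g y (f @^-1` N)).2; rewrite /f /= actM.
Qed.

End HaarNull.

(** * Convolution powers *)

(** Induction on [n]: the first step has mean at most the current value by
   superharmonicity, and Fubini's theorem exchanges the factors of the
   convolution.  The measure [lambda] carries the probability structure that
   the set function [convpow mu n] lacks. *)
Lemma superharmonic_convpow n (h : borelType X -> R) : unit_fun h ->
  (forall x, avg h x <= h x) ->
  exists lambda : probability (borelType G) R, convpow mu n = lambda /\
    forall x, (\int[lambda]_g (h (act g x))%:E <= (h x)%:E)%E.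
Proof.
move=> uh ah; have h0 x : (0 <= (h x)%:E)%E.
  by rewrite lee_fin; case: uh => _ /(_ x)/andP[].
have mh x : measurable_fun [set: borelType G] (fun g => (h (act g x))%:E).
  by apply/measurable_EFinP; case: (unit_fun_act act_meas x uh).
elim: n => [|n [lambda [lambdaE IH]]].
  exists (\d_(1%g : borelType G)); split=> // x.
  by rewrite integral_dirac // diracT mul1e act1.
pose mulf : {mfun (borelType G * borelType G)%type >-> borelType G} :=
  HB.pack (fun p : borelType G * borelType G => (p.1 * p.2)%g : borelType G)
    (isMeasurableFun.Build _ _ _ _ _ mul_meas).
pose PP : probability (borelType G * borelType G)%type R := (mu \x lambda)%E.
exists (distribution PP mulf); split.
  by rewrite /convpow iterS -/(convpow mu n) lambdaE.
move=> x; rewrite ge0_integral_distribution //.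
pose k (p : borelType G * borelType G) := (h (act ((p.1 : G) * p.2)%g x))%:E.
have mk : measurable_fun [set: borelType G * borelType G] k.
  exact: (measurableT_comp (mh x) mul_meas).
rewrite (fubini_tonelli2 (m1 := mu) (m2 := lambda) k) //=; last by move=> p; exact: h0.
apply: le_trans (IH x); apply: ge0_le_integral => //.
- by move=> g _; apply: integral_ge0 => g' _; exact: h0.
- exact: (measurable_fun_fubini_tonelli_G (m1 := mu) k mk (fun=> h0 _)).
- move=> g _; apply: le_trans (_ : (avg h (act g x))%:E <= _)%E; last by rewrite lee_fin.
  rewrite avgE // le_eqVlt; apply/orP; left; apply/eqP.
  by apply: eq_integral => g' _; rewrite /k /= actM.
Qed.

Let mact_orbit x :
  measurable_fun [set: borelType G] ((fun g => act g x) : borelType G -> borelType X).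
Proof.
exact: (measurable_fun_pair1
  (f := fun p : borelType G * borelType X => act p.1 p.2 : borelType X)).
Qed.

(** The probability [mu^*n] cannot be arbitrarily close to [1] on Haar-null sets:
   it would be [1] on their union.  Hence the set of the [g] with [h (g x) < 1],
   which is Haar-null, has [mu^*n]-measure at most [1 - d], and [h] is at least
   [inf h] there. *)
Lemma superharmonic_eq1 (h : borelType X -> R) : unit_fun h ->
  (forall x, avg h x <= h x) -> mX [set x | h x < 1] = 0%E -> mX setT <> 0%E ->
  forall (mG : {sigma_finite_measure set (borelType G) -> \bar R}) n,
  (forall g (A : set (borelType G)), measurable A ->
    mG ((fun h : G => g * h)%g @` A) = mG A) -> mG setT <> 0%E ->
  ~ mutually_singular (convpow mu n) mG ->
  forall x, h x = 1.
Proof.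
move=> uh ah N0 mX0 mG n mG_inv mG0 nsing.
have [lambda [lambdaE hl]] := superharmonic_convpow n uh ah.
have [mh h01] := uh.
have [d d0 dP] : exists2 d : R, 0 < d & forall A : set (borelType G),
    measurable A -> mG A = 0%E -> (lambda A <= (1 - d)%:E)%E.
  apply: contrapT => nd; apply: nsing.
  have big k : exists A : set (borelType G), [/\ measurable A, mG A = 0%E &
      ((1 - k.+1%:R^-1)%:E < lambda A)%E].
    apply: contrapT => nA; apply: nd; exists k.+1%:R^-1 => // A mA A0.
    by rewrite leNgt; apply/negP => kA; apply: nA; exists A.
  pose A k := projT1 (cid (big k)); have AP k := projT2 (cid (big k)).
  have mA k : measurable (A k) by case: (AP k).
  have mUA : measurable (\bigcup_k A k) by exact: bigcupT_measurable.
  exists (~` \bigcup_k A k); split; first exact: measurableC.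
    rewrite lambdaE probability_setC //.
    have -> : lambda (\bigcup_k A k) = 1%E; last by rewrite subee.
    apply/eqP; rewrite eq_le probability_le1 //=.
    rewrite -(@fineK _ (lambda _)) ?fin_num_measure // lee_fin.
    apply/ler_addgt0Pl => e e0.
    have [k ke] : exists k : nat, k.+1%:R^-1 < e.
      have [//|k] := @ltr_add_invr R 0 e _; by rewrite add0r; exists k.
    have : ((1 - k.+1%:R^-1)%:E <= lambda (\bigcup_k A k))%E.
      have [_ _ /ltW /le_trans] := AP k; apply.
      apply: le_measure; [rewrite inE; exact: mA|by rewrite inE|].
      by move=> g Ag; exists k.
    rewrite -{1}(@fineK _ (lambda _)) ?fin_num_measure // lee_fin => le1.
    apply: le_trans (_ : e + (1 - k.+1%:R^-1) <= _); last by rewrite lerD2l.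
    by rewrite addrCA lerDl subr_ge0 ltW.
  rewrite setCK; have /negligibleP : mG.-negligible (\bigcup_k A k).
    apply: negligible_bigcup => k; exists (A k); split=> //.
    by case: (AP k).
  exact.
pose s := inf (range h).
have hlb : has_lbound (range h) by exists 0 => _ [x _ <-]; case/andP: (h01 x).
have hs x : s <= h x by apply: ge_inf => //; exists x.
have key x : 1 - (1 - s) * (1 - d) <= h x.
  pose D : set (borelType G) := [set g | h (act g x) < 1].
  have mN : measurable ([set y | h y < 1] : set (borelType X)).
    by rewrite -[X in measurable X]setTI; apply: measurable_fun_ltr.
  have mD : measurable D.
    by rewrite -[X in measurable X]setTI; apply: (mact_orbit x measurableT mN).
  have D0 : mG D = 0%E by exact: (haar_null_orbit mG_inv mG0 mX0 x mN N0).
  have s1 : s <= 1 by apply: le_trans (hs point) _; case/andP: (h01 point).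
  rewrite -lee_fin; apply: le_trans (hl x).
  have uD : unit_fun (\1_D : borelType G -> R) by exact: unit_fun_indic.
  have u1 := unit_fun_cst1 (borelType G) R.
  have uhx := unit_fun_act act_meas x uh.
  rewrite -Rintegral_unit_funE // lee_fin.
  pose S : seq (R * (borelType G -> R)) := [:: (1, cst 1); (- (1 - s), \1_D)].
  have [|iS SE] := @Rintegral_lincomb _ _ _ lambda S.
    by rewrite /= !unit_fun_integrable.
  apply: le_trans (_ : \int[lambda]_g (\sum_(p <- S) p.1 * p.2 g) <= _); last first.
    apply: le_Rintegral => // [|g _]; first exact: unit_fun_integrable.
    rewrite !big_cons big_nil /= /cst indicE; have := hs (act g x).
    have [Dg|Dg] := pselect (D g); first by rewrite mem_set //=; lra.
    by rewrite memNset //=; move/negP: Dg; rewrite -leNgt; lra.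
  rewrite SE !big_cons big_nil /= Rintegral_probability1.
  have : \int[lambda]_g (\1_D : borelType G -> R) g <= 1 - d.
    by rewrite -lee_fin Rintegral_unit_funE // integral_indic // setIT dP.
  have := s1; nra.
have s1 : 1 <= s.
  have : 1 - (1 - s) * (1 - d) <= s.
    by apply: lb_le_inf => [|_ [x _ <-]]; [exists (h point); exists point|exact: key].
  nra.
by move=> x; apply/eqP; rewrite eq_le (le_trans s1) // andbT; case/andP: (h01 x).
Qed.

End Walk.

(** * Recurrence under quadratic growth *)

Section SigmaFiniteOf.
Context d (T : measurableType d) (R : realType) (m : {measure set T -> \bar R}).

(** Fubini's theorem is stated for bundled sigma-finite measures. *)
Definition sigma_finite_of of sigma_finite setT m : set T -> \bar R := m.

Hypothesis m_sf : sigma_finite setT m.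

Let m0 : sigma_finite_of m_sf set0 = 0%E. Proof. exact: measure0. Qed.

Let m_ge0 A : (0 <= sigma_finite_of m_sf A)%E. Proof. exact: measure_ge0. Qed.

Let m_sigma_additive : semi_sigma_additive (sigma_finite_of m_sf).
Proof. exact: measure_semi_sigma_additive. Qed.

HB.instance Definition _ := isMeasure.Build _ _ _ (sigma_finite_of m_sf)
  m0 m_ge0 m_sigma_additive.

HB.instance Definition _ :=
  Measure_isSigmaFinite.Build _ _ _ (sigma_finite_of m_sf) m_sf.

End SigmaFiniteOf.

Lemma poly_growth_bound (R : realType) (G : topologicalGroupType) (X : ptopologicalType)
    (act : G -> X -> X) (m : {measure set (borelType X) -> \bar R}) d :
  poly_growth act m d -> exists (V : set G) (x : X) (C : R) (n1 : nat),
    [/\ nbhs (1%g : G) V, \bigcup_n setpowg V n = setT,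
        forall n, measurable (orbit_ball act V x n : set (borelType X)) &
        forall n, (n1 <= n)%N -> (m (orbit_ball act V x n) <= (C * n%:R ^+ d)%:E)%E].
Proof.
move=> [V [x [V1 _ VT mV]]] /ereal_inf_lt[_ [N [n1 _ n1N] <-] supoo].
set u := fun n : nat => _ in supoo.
have [C CP] : exists C : R, forall n, (n1.+1 <= n)%N -> (u n <= C%:E)%E.
  have leu n : (n1.+1 <= n)%N -> (u n <= ereal_sup [set u k | k in N])%E.
    by move=> nn; apply: ereal_sup_ubound; exists n => //; apply: n1N; exact: ltnW.
  move: supoo leu; case: (ereal_sup _) => [C _ leu|//|_ leu]; first by exists C.
  by exists 0 => n /leu /le_trans; apply; exact: leNye.
(* Index [0] is excluded since [n ^+ d] is inverted. *)
exists V, x, C, n1.+1; split=> // n nn; have n0 : (0 < n)%N by exact: leq_trans nn.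
have nd0 : 0 < n%:R ^+ d :> R by rewrite exprn_gt0 // ltr0n.
by have := CP n nn; rewrite /u lee_pdivrMr // -EFinM.
Qed.

Lemma radon_sigma_finite (R : realType) (G : topologicalGroupType)
    (m : {measure set (borelType G) -> \bar R}) :
  hausdorff_space G -> sigma_compact G -> radon m -> sigma_finite setT m.
Proof.
move=> hG [K Kc KT] [mK _ _]; exists K => [|n]; first by rewrite KT.
split; last exact: mK.
by apply: closed_measurable_borel; exact: compact_closed.
Qed.

Section TransitiveAction.
Variables (R : realType) (G : topologicalGroupType) (X : ptopologicalType).
Variable act : G -> X -> X.
Hypotheses (act1 : forall x, act 1%g x = x)
  (actM : forall g h x, act (g * h)%g x = act g (act h x))
  (act_trans : forall x y, exists g, act g x = y)
  (act_cont : continuous (fun p : G * X => act p.1 p.2))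
  (act_open : forall x A, open A -> open [set act g x | g in A])
  (G2 : @second_countable G) (X2 : @second_countable X)
  (hG : hausdorff_space G) (Gsigma : sigma_compact G).

(** A neighborhood of [x] may be replaced by a smaller one; an open one inside
   some [V^r x0] is visited with probability [1] from every point. *)
Theorem quadratic_growth_recurrent (mX : {measure set (borelType X) -> \bar R})
    (mu : probability (borelType G) R) :
  haar act mX -> poly_growth act mX 2 -> adapted mu -> symmetric_law mu ->
  spread_out mu -> compact (msupp mu) -> topologically_Harris_recurrent act mu.
Proof.
move=> [_ mX0 mX_inv] /poly_growth_bound[V [x0 [C [n1 [V1 VT mV growth]]]]].
move=> mu_ad mu_sym [mG0 [n [[mG_radon mG_nz mG_inv] _ nsing]]] mu_comp.
have mX_sf : sigma_finite setT mX.
  exists (fun k => orbit_ball act V x0 (k + n1)) => [|k]; last first.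
    by split; [exact: mV|apply: le_lt_trans (growth _ (leq_addl _ _)) _; rewrite ltry].
  apply/seteqP; split=> // y _; have [g <-] := act_trans x0 y.
  have [k _ Vg] : (\bigcup_n setpowg V n) g by rewrite VT.
  by exists k => //; exists g => //; apply: subset_setpowg Vg => //; exact: leq_addr.
pose m : {sigma_finite_measure set (borelType X) -> \bar R} := sigma_finite_of mX_sf.
have mG_sf := radon_sigma_finite hG Gsigma mG_radon.
pose mG : {sigma_finite_measure set (borelType G) -> \bar R} := sigma_finite_of mG_sf.
move=> d Omega P Y [indep lawY] x B /nbhs_interior nB.
have act_meas : measurable_fun [set: borelType G * borelType X]
    (fun p : borelType G * borelType X => act p.1 p.2 : borelType X).
  exact: (continuous_measurable_prod G2 X2 act_cont).
have [g gx] := act_trans x0 x.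
have [r _ Vr] : (\bigcup_n setpowg V n) g by rewrite VT.
pose A : set (borelType X) := B° `&` [set act h x | h in V°].
have oA : open (A : set X).
  by apply: openI; [exact: open_interior|apply: act_open; exact: open_interior].
have mA : measurable A by exact: open_measurable_borel.
have Ax : A x by split; [exact: nbhs_singleton nB|exists 1%g => //; exact: act1].
have Ar : A `<=` orbit_ball act V x0 r.+1.
  move=> _ [_ [h /interior_subset Vh <-]]; exists (h * g)%g; last by rewrite actM gx.
  by exists h => //; exists g.
pose bact : borelType G -> borelType X -> borelType X := act.
have harm : {ae m, forall y, avg mu bact (hitting mu bact A) y = hitting mu bact A y}.
  exact: (ae_avg_hitting_walk act1 actM act_trans act_cont G2 X2 (mX := m) mX_inv mu_sym
    mu_comp V1 VT mV growth mA Ar).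
have uh := unit_fun_hitting mu act_meas mA.
have h1A y : A y -> hitting mu bact A y = 1 by exact: hitting_in.
have null : m [set y | hitting mu bact A y < 1] = 0%E.
  apply: (propagation act1 actM act_trans act_cont G2 X2 (mX := m) mX_inv mu_sym mu_ad
    uh harm oA _ h1A).
  by exists x.
have h1 : forall y, hitting mu bact A y = 1.
  apply: (superharmonic_eq1 act1 actM act_trans act_cont G2 X2 (mX := m) mX_inv uh _
    null mX0 (mG := mG) mG_inv mG_nz nsing).
  by move=> y; exact: avg_hitting_le.
have walkE w k : walk act Y x k w = driven Y (fun=> bact) x k w by elim: k => //= k ->.
have mY k : measurable_fun [set: Omega] (Y k) by [].
have indep' (J : {fset nat}) (D : nat -> set (borelType G)) :
    (forall j, measurable (D j)) ->
    P (\bigcap_(j in [set` J]) (Y j @^-1` D j)) = (\prod_(j <- J) mu (D j))%E.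
  move=> mD; rewrite indep //; apply: eq_bigr => j _; exact: lawY.
have [M [mM M0 AM]] := @ae_recurrent _ _ _ _ _ (borelType X) _ P mu Y bact x mY indep'
  act_meas A mA h1.
exists M; split=> // w /= nw; apply: AM => /= Aw; apply: nw => k _.
have [j kj [Bj _]] := Aw k I; exists j => //=.
by apply: (interior_subset (A := B)); rewrite walkE.
Qed.

End TransitiveAction.

Theorem theorem1p9 (R : realType) (G : topologicalGroupType)
    (Gsigma : sigma_compact G) (Glc : locally_compact [set: G])
    (Gmetr : metrizable R G)
    (Gamma : groupClosed G) (Gamma_discrete : discrete_subset (T := G) [set` Gamma])
    (mX : {measure set (borelType (coset_space Gamma)) -> \bar R})
    (mX_haar : haar (@coset_act G Gamma) mX)
    (mX_growth : poly_growth (@coset_act G Gamma) mX 2%N)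
    (mu : probability (borelType G) R)
    (mu_adapted : adapted mu) (mu_sym : symmetric_law mu)
    (mu_spread : spread_out mu) (mu_compact : compact (msupp mu)) :
  topologically_Harris_recurrent (@coset_act G Gamma) mu.
Proof.
have G2 := metrizable_sigma_compact_second_countable Gmetr Gsigma.
apply: (quadratic_growth_recurrent _ _ _ _ _ G2 _ _ Gsigma mX_haar) => //.
- exact: coset_act1.
- by move=> g h x; rewrite coset_actM.
- exact: coset_act_transitive.
- exact: coset_act_continuous.
- exact: open_coset_orbit.
- exact: coset_space_second_countable.
- exact: metrizable_hausdorff Gmetr.
Qed.
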